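(* Let $H$ be a pointed Hopf algebra over a field $\Bbbk$. Then the following hold. (a) There exists a generating set $X$ of $H$ such that $\pi(X_{I})$ generates $H$ as an algebra. That is, there exist a well-ordered set $(O,<_O)$, a subset $D\subseteq O$ with mirror set $D^{*}$, and an assignment map $f_X:X=O\cup D^{*}\to H$ whose image generates $H$ as a $\Bbbk$-algebra, such that, if $\pi:\Bbbk\langle X\rangle\to H$ is the canonical projection induced by $f_X$, $I=\ker\pi$, and $X_{I}$ is the set of $I$-irreducible letters of $X$ with respect to the reduction order, then $\pi(X_{I})$ generates $H$ as a $\Bbbk$-algebra. (b) If $H$ is right or left Noetherian, then $H$ is affine.
   Context: A coalgebra (or Hopf algebra) over $\Bbbk$ is pointed if its coradical (the sum of its simple subcoalgebras) is the span of its group-like elements. A $\Bbbk$-algebra is affine if it is finitely generated as a $\Bbbk$-algebra. Letters and words. Let $(O,<_O)$ be a well-ordered set, $D\subseteq O$ a subset, $D^{*}=\{x^{*}\mid x\in D\}$ a formal copy of $D$ disjoint from $O$ (the mirror set), and $X=O\cup D^{*}$. For $x\in O$ put $o(x)=x$; for $x\in D$ put $o(x^{*})=x$. The order on $X$ is: $x\prec y$ iff $o(x)<_O o(y)$, or $o(x)=o(y)=x$ and $y=x^{*}$; it is a well order extending $<_O$. $\langle X\rangle$ is the free monoid on $X$ with empty word $1$, and $\Bbbk\langle X\rangle$ is the free algebra on $X$. $|\alpha|$ is the length of $\alpha$; for non-empty $\alpha$, $o(\alpha)$ is $o$ of the first letter of $\alpha$. The lexicographic order: $\alpha\prec_{\mathrm{lex}}\beta$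 iff $\alpha$ is a proper prefix of $\beta$, or $\alpha=\gamma x\eta$, $\beta=\gamma y\zeta$ with letters $x\prec y$. Reduction order $\prec_{r}$ on $\langle X\rangle$: $1\prec_r\alpha$ for every non-empty $\alpha$; for non-empty $\alpha,\beta$, $\alpha\prec_r\beta$ iff $o(\alpha)\prec o(\beta)$, or $o(\alpha)=o(\beta)$ and either $|\alpha|<|\beta|$, or $|\alpha|=|\beta|$ and $\alpha\prec_{\mathrm{lex}}\beta$. It is a well order. Irreducibility. The leading word $\mathrm{LW}(f)$ of $0\ne f\in\Bbbk\langle X\rangle$ is the $\prec_r$-greatest word with nonzero coefficient in $f$. For an ideal $I$, a word $\alpha$ is $I$-reducible if $\alpha=\mathrm{LW}(f)$ for some nonzero $f\in I$, and $I$-irreducible otherwise; $X_I$ is the set of letters $x\in X$ that are $I$-irreducible. *)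

(* Defs.v *)
From HB Require Import structures.
From mathcomp Require Import all_boot all_algebra.
From mathcomp Require Import generic_quotient boolp classical_sets wochoice.
From mathcomp Require Import finmap.
From mathcomp.multinomials Require Import monalg.

Set Implicit Arguments.
Unset Strict Implicit.
Unset Printing Implicit Defensive.

Import GRing.Theory.
Local Open Scope ring_scope.
Local Open Scope quotient_scope.
Local Open Scope classical_set_scope.

Section Tensor.
Context (k : fieldType) (V W : lmodType k).

(* The sequence [:: (v_1, w_1); ...; (v_n, w_n)] stands for the formal sum of
   the v_i (x) w_i; tens_rel is the congruence generated by bilinearity. *)
Inductive tens_rel : seq (V * W) -> seq (V * W) -> Prop :=
| tens_rel_refl s : tens_rel s s
| tens_rel_sym s t : tens_rel s t -> tens_rel t s
| tens_rel_trans s t u : tens_rel s t -> tens_rel t u -> tens_rel s u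
| tens_rel_cat s s' t t' :
    tens_rel s s' -> tens_rel t t' -> tens_rel (s ++ t) (s' ++ t')
| tens_rel_catC s t : tens_rel (s ++ t) (t ++ s)
| tens_rel0 w : tens_rel [:: (0, w)] [::]
| tens_relDl v v' w : tens_rel [:: (v + v', w)] [:: (v, w); (v', w)]
| tens_relDr v w w' : tens_rel [:: (v, w + w')] [:: (v, w); (v, w')]
| tens_relZ a v w : tens_rel [:: (a *: v, w)] [:: (v, a *: w)].

Definition tens_relb (s t : seq (V * W)) : bool := `[< tens_rel s t >].

Fact tens_relb_equiv : equiv_class_of tens_relb.
Proof.
split=> [s | s t | t s u].
- exact/asboolP/tens_rel_refl.
- by apply/asboolP/asboolP; apply: tens_rel_sym.
- by move=> /asboolP st /asboolP tu; apply/asboolP/(tens_rel_trans st tu).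
Qed.

Canonical tens_equiv := EquivRelPack tens_relb_equiv.

Definition tensor := {eq_quot tens_equiv}.

HB.instance Definition _ := Choice.on tensor.

Definition tens_class (s : seq (V * W)) : tensor := \pi_(tensor) s.

Definition tens (v : V) (w : W) : tensor := tens_class [:: (v, w)].

Lemma tens_classP s t : tens_class s = tens_class t <-> tens_rel s t.
Proof.
split=> [/eqP st | st]; last exact/eqquotP/asboolP.
by apply/asboolP; move: st; rewrite eqmodE.
Qed.

Lemma tens_repr (t : tensor) : tens_class (repr t) = t.
Proof. exact: reprK. Qed.

Lemma repr_tens_class s : tens_rel (repr (tens_class s)) s.
Proof. by apply/tens_classP; rewrite tens_repr. Qed.

Definition tensor_add (s t : tensor) := tens_class (repr s ++ repr t).

Definition tensor_scale (a : k) (t : tensor) :=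
  tens_class [seq (a *: p.1, p.2) | p <- repr t].

Lemma tensor_addE s t :
  tensor_add (tens_class s) (tens_class t) = tens_class (s ++ t).
Proof. by apply/tens_classP/tens_rel_cat; apply: repr_tens_class. Qed.

Lemma tens_rel_scale a s t : tens_rel s t ->
  tens_rel [seq (a *: p.1, p.2) | p <- s] [seq (a *: p.1, p.2) | p <- t].
Proof.
elim=> {s t} /=.
- by move=> s; apply: tens_rel_refl.
- by move=> s t _; apply: tens_rel_sym.
- by move=> s t u _ st _; apply: tens_rel_trans st.
- by move=> s s' t t' _ ss _ tt; rewrite !map_cat; apply: tens_rel_cat.
- by move=> s t; rewrite !map_cat; apply: tens_rel_catC.
- by move=> w; rewrite scaler0; apply: tens_rel0.
- by move=> v v' w; rewrite scalerDr; apply: tens_relDl.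
- by move=> v w w'; apply: tens_relDr.
- move=> b v w; rewrite scalerA mulrC -scalerA; exact: tens_relZ.
Qed.

Lemma tensor_scaleE a s :
  tensor_scale a (tens_class s) = tens_class [seq (a *: p.1, p.2) | p <- s].
Proof. by apply/tens_classP/tens_rel_scale/repr_tens_class. Qed.

Fact tensor_addA : associative tensor_add.
Proof.
by move=> s t u; rewrite -[s]tens_repr -[t]tens_repr -[u]tens_repr !tensor_addE catA.
Qed.

Fact tensor_addC : commutative tensor_add.
Proof.
move=> s t; rewrite -[s]tens_repr -[t]tens_repr !tensor_addE.
exact/tens_classP/tens_rel_catC.
Qed.

Fact tensor_add0 : left_id (tens_class [::]) tensor_add.
Proof. by move=> s; rewrite -[s]tens_repr !tensor_addE. Qed.

Lemma tens_rel_scaleD a b s :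
  tens_rel [seq ((a + b) *: p.1, p.2) | p <- s]
    ([seq (a *: p.1, p.2) | p <- s] ++ [seq (b *: p.1, p.2) | p <- s]).
Proof.
elim: s => [|[v w] s IH] /=; first exact: tens_rel_refl.
rewrite scalerDl -cat1s.
apply: tens_rel_trans (tens_rel_cat (tens_relDl _ _ _) IH) _.
rewrite -[_ :: (_ ++ _)]cat1s -[[:: _; _]]/([:: _] ++ [:: _]) -!catA.
apply: tens_rel_cat; first exact: tens_rel_refl.
rewrite -[(b *: v, w) :: map _ _]cat1s !catA.
by apply: tens_rel_cat; [exact: tens_rel_catC | exact: tens_rel_refl].
Qed.

Lemma tens_rel_scale0 s : tens_rel [seq (0 *: p.1, p.2) | p <- s] [::].
Proof.
elim: s => [|[v w] s IH] /=; first exact: tens_rel_refl.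
by rewrite scale0r -cat1s -[[::]]cats0; apply: tens_rel_cat => //; apply: tens_rel0.
Qed.

Fact tensor_addN : left_inverse (tens_class [::]) (tensor_scale (-1)) tensor_add.
Proof.
move=> s; rewrite -[s]tens_repr tensor_scaleE tensor_addE; apply/tens_classP.
apply: tens_rel_trans (tens_rel_scale0 (repr s)).
rewrite -[X in _ ++ X]map_id -(addNr 1).
have -> : map id (repr s) = [seq (1 *: p.1, p.2) | p <- repr s].
  by apply: eq_map => -[v w]; rewrite scale1r.
exact/tens_rel_sym/tens_rel_scaleD.
Qed.

HB.instance Definition _ := GRing.isZmodule.Build tensor
  tensor_addA tensor_addC tensor_add0 tensor_addN.

Lemma tens_class_cat s t : tens_class (s ++ t) = tens_class s + tens_class t.
Proof. by rewrite -tensor_addE. Qed.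

Fact tensor_scaleA a b t :
  tensor_scale a (tensor_scale b t) = tensor_scale (a * b) t.
Proof.
rewrite -[t]tens_repr !tensor_scaleE -map_comp; congr tens_class.
by apply: eq_map => p /=; rewrite scalerA.
Qed.

Fact tensor_scale1 : left_id 1 tensor_scale.
Proof.
move=> t; rewrite -[t]tens_repr tensor_scaleE; congr tens_class.
by rewrite -[RHS]map_id; apply: eq_map => -[v w]; rewrite scale1r.
Qed.

Fact tensor_scaleDr : right_distributive tensor_scale +%R.
Proof.
move=> a s t; rewrite -[s]tens_repr -[t]tens_repr -tens_class_cat.
by rewrite !tensor_scaleE map_cat tens_class_cat.
Qed.

Fact tensor_scaleDl t : {morph tensor_scale^~ t : a b / a + b}.
Proof.
move=> a b; rewrite -[t]tens_repr !tensor_scaleE -tens_class_cat.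
exact/tens_classP/tens_rel_scaleD.
Qed.

HB.instance Definition _ := GRing.Zmodule_isLmodule.Build k tensor
  tensor_scaleA tensor_scale1 tensor_scaleDr tensor_scaleDl.

Lemma tens_is_linear_l w : linear (tens^~ w).
Proof.
move=> a v v'; rewrite -[a *: tens v w]/(tensor_scale a _) tensor_scaleE.
by rewrite -tens_class_cat; apply/tens_classP/tens_relDl.
Qed.

Lemma tens_is_linear_r v : linear (tens v).
Proof.
move=> a w w'; rewrite -[a *: tens v w]/(tensor_scale a _) tensor_scaleE.
rewrite -tens_class_cat; apply/tens_classP.
apply: tens_rel_trans (tens_relDr _ _ _) _.
rewrite -cat1s -[X in tens_rel _ X]cat1s; apply: tens_rel_cat; last exact: tens_rel_refl.
exact/tens_rel_sym/tens_relZ.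
Qed.

Lemma tens_classE s : tens_class s = \sum_(p <- s) tens p.1 p.2.
Proof.
elim: s => [|[v w] s IH]; first by rewrite big_nil.
by rewrite big_cons -IH -cat1s tens_class_cat.
Qed.

Lemma tensorE (t : tensor) : t = \sum_(p <- repr t) tens p.1 p.2.
Proof. by rewrite -tens_classE tens_repr. Qed.

(* The linear map induced by B; it is meaningful when B is bilinear, by
   tlift_tens and tlift_is_linear below. *)
Definition tlift (U : lmodType k) (B : V -> W -> U) (t : tensor) : U :=
  \sum_(p <- repr t) B p.1 p.2.

Section Lift.
Context (U : lmodType k) (B : V -> W -> U).
Hypothesis Bl : forall w, linear (B^~ w).
Hypothesis Br : forall v, linear (B v).

Lemma tlift_class s : tlift B (tens_class s) = \sum_(p <- s) B p.1 p.2.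
Proof.
suff rel_sum s' t : tens_rel s' t ->
    \sum_(p <- s') B p.1 p.2 = \sum_(p <- t) B p.1 p.2.
  exact: rel_sum (repr_tens_class s).
elim=> {s s' t} //=.
- by move=> s t u _ -> _ ->.
- by move=> s s' t t' _ ss _ tt; rewrite !big_cat /= ss tt.
- by move=> s t; rewrite !big_cat /= addrC.
- move=> w; rewrite big_seq1 big_nil /=.
  by have := Bl w (-1) 0 0; rewrite scaler0 addr0 scaleN1r addNr.
- move=> v v' w; rewrite !big_cons !big_nil !addr0 /=.
  by have := Bl w 1 v v'; rewrite !scale1r.
- move=> v w w'; rewrite !big_cons !big_nil !addr0 /=.
  by have := Br v 1 w w'; rewrite !scale1r.
- move=> a v w; rewrite !big_seq1 /=.
  have B0l : B 0 w = 0.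
    by have := Bl w (-1) 0 0; rewrite scaler0 addr0 scaleN1r addNr.
  have B0r : B v 0 = 0.
    by have := Br v (-1) 0 0; rewrite scaler0 addr0 scaleN1r addNr.
  have := Bl w a v 0; have := Br v a w 0.
  by rewrite /= !addr0 B0l B0r !addr0 => -> ->.
Qed.

Lemma tlift_tens v w : tlift B (tens v w) = B v w.
Proof. by rewrite tlift_class big_seq1. Qed.

Lemma tlift_is_linear : linear (tlift B).
Proof.
move=> a s t; rewrite -[s]tens_repr -[t]tens_repr.
rewrite -[a *: _]/(tensor_scale a _) tensor_scaleE -tens_class_cat !tlift_class.
rewrite big_cat big_map scaler_sumr /=; congr (_ + _).
apply: eq_bigr => p _; have := Bl p.2 a p.1 0.
have -> : B 0 p.2 = 0.
  by have := Bl p.2 (-1) 0 0; rewrite scaler0 addr0 scaleN1r addNr.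
by rewrite !addr0.
Qed.

End Lift.
End Tensor.

Definition tmap (k : fieldType) (V V' W W' : lmodType k)
    (f : V -> V') (g : W -> W') : tensor V W -> tensor V' W' :=
  tlift (fun v w => tens (f v) (g w)).

Definition tassoc (k : fieldType) (U V W : lmodType k) :
    tensor (tensor U V) W -> tensor U (tensor V W) :=
  tlift (fun t w => tlift (fun u v => tens u (tens v w)) t).

Definition tmul (k : fieldType) (A : algType k) (s t : tensor A A) : tensor A A :=
  tlift (fun a b => tlift (fun c d => tens (a * c) (b * d)) t) s.

Section TensorMaps.
Context (k : fieldType).

Lemma tmap_tens (V V' W W' : lmodType k)
    (f : {linear V -> V'}) (g : {linear W -> W'}) v w :
  tmap f g (tens v w) = tens (f v) (g w).
Proof.
apply: tlift_tens => [w' | v'] a x y; rewrite linearP.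
  exact: tens_is_linear_l.
exact: tens_is_linear_r.
Qed.

Lemma tassoc_tens (U V W : lmodType k) (u : U) (v : V) (w : W) :
  tassoc (tens (tens u v) w) = tens u (tens v w).
Proof.
have lin (w' : W) : (forall v' : V, linear (fun u' : U => tens u' (tens v' w')))
    /\ (forall u' : U, linear (fun v' : V => tens u' (tens v' w'))).
  split=> z a x y; first exact: tens_is_linear_l.
  by rewrite tens_is_linear_l tens_is_linear_r.
have [linl linr] := lin w; rewrite /tassoc tlift_tens.
- by rewrite tlift_tens.
- by move=> w'; have [? ?] := lin w'; apply: tlift_is_linear.
- move=> t a x y; rewrite /tlift scaler_sumr -big_split /=.
  by apply: eq_bigr => p _; rewrite tens_is_linear_r tens_is_linear_r.
Qed.

Lemma tmul_tens (A : algType k) (a b c d : A) :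
  tmul (tens a b) (tens c d) = tens (a * c) (b * d).
Proof.
have linl (x y z : A) : linear (fun c : A => tens (x * c) (y * z)).
  by move=> r u v; rewrite mulrDr -scalerAr tens_is_linear_l.
have linr (x y z : A) : linear (fun d : A => tens (x * z) (y * d)).
  by move=> r u v; rewrite mulrDr -scalerAr tens_is_linear_r.
rewrite /tmul tlift_tens.
- by rewrite tlift_tens.
- move=> w r x y; rewrite /tlift scaler_sumr -big_split /=.
  by apply: eq_bigr => p _; rewrite mulrDl -scalerAl tens_is_linear_l.
- move=> w r x y; rewrite /tlift scaler_sumr -big_split /=.
  by apply: eq_bigr => p _; rewrite mulrDl -scalerAl tens_is_linear_r.
Qed.

End TensorMaps.

HB.mixin Record Lmodule_isCoalgebra (k : fieldType) C of GRing.Lmodule k C := {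
  comul : {linear C -> tensor C C};
  counit : {scalar C};
  comulA : forall x : C, tassoc (tmap comul idfun (comul x)) = tmap idfun comul (comul x);
  counitl : forall x : C, tlift (fun y z => counit y *: z) (comul x) = x;
  counitr : forall x : C, tlift (fun y z => counit z *: y) (comul x) = x
}.

#[short(type="coalgType")]
HB.structure Definition Coalgebra (k : fieldType) :=
  {C of GRing.Lmodule k C & Lmodule_isCoalgebra k C}.

HB.mixin Record Coalgebra_isHopf (k : fieldType) H
    of GRing.Algebra k H & Coalgebra k H := {
  comul1 : comul (1 : H) = tens 1 1;
  comulM : forall x y : H, comul (x * y) = tmul (comul x) (comul y);
  counit1 : counit (1 : H) = 1;
  counitM : forall x y : H, counit (x * y) = counit x * counit y;
  antipode : {linear H -> H};
  antipodel : forall x : H,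
    tlift (fun y z => antipode y * z) (comul x) = (counit x)%:A;
  antipoder : forall x : H,
    tlift (fun y z => y * antipode z) (comul x) = (counit x)%:A
}.

#[short(type="hopfAlgType")]
HB.structure Definition HopfAlgebra (k : fieldType) :=
  {H of GRing.Algebra k H & Coalgebra k H & Coalgebra_isHopf k H}.

Definition subspace (k : fieldType) (V : lmodType k) : set (set V) :=
  [set A | GRing.submod_closed (mem A)].

Definition lspan (k : fieldType) (V : lmodType k) (A : set V) : set V :=
  smallest (@subspace k V) A.

(* The image of A (x) B in V (x) W. *)
Definition tensor_subspace (k : fieldType) (V W : lmodType k)
    (A : set V) (B : set W) : set (tensor V W) :=
  lspan [set tens a b | a in A & b in B].

Section Pointed.
Context (k : fieldType) (C : coalgType k).

Definition subcoalgebra : set (set C) :=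
  [set A | subspace A /\ forall x, A x -> tensor_subspace A A (comul x)].

Definition simple_subcoalgebra : set (set C) :=
  [set A | [/\ subcoalgebra A, A <> [set 0] &
    forall B, subcoalgebra B -> B `<=` A -> B = [set 0] \/ B = A]].

(* A sum of subspaces is the span of their union. *)
Definition coradical : set C := lspan (\bigcup_(A in simple_subcoalgebra) A).

Definition grouplike : set C := [set g | comul g = tens g g /\ counit g = 1].

Definition pointed : Prop := coradical = lspan grouplike.

End Pointed.

Section Generation.
Context (k : fieldType) (A : algType k).

Definition subalgebra : set (set A) := [set B | GRing.subalg_closed (mem B)].

Definition generates_algebra (S : set A) : Prop := smallest subalgebra S = setT.

Definition affine : Prop := exists s : seq A, generates_algebra [set` s].

End Generation.

Section Noetherian.
Context (R : nzRingType).

Definition left_ideal : set (set R) :=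
  [set J | [/\ J 0, forall x y, J x -> J y -> J (x + y) & forall a x, J x -> J (a * x)]].

Definition right_ideal : set (set R) :=
  [set J | [/\ J 0, forall x y, J x -> J y -> J (x + y) & forall a x, J x -> J (x * a)]].

Definition ascending_chain_condition (P : set (set R)) : Prop :=
  forall J : nat -> set R, (forall n, P (J n)) -> (forall n, J n `<=` J n.+1) ->
    exists n, forall m, (n <= m)%N -> J m = J n.

Definition left_noetherian : Prop := ascending_chain_condition left_ideal.
Definition right_noetherian : Prop := ascending_chain_condition right_ideal.

End Noetherian.

(* X = O + D^*: inl x is the letter x of O, and inr x is its mirror x^*, for x in D. *)
Definition letter (O : choiceType) (D : {pred O}) : choiceType :=
  (O + {x : O | x \in D})%type.

Section Words.
Context (O : choiceType) (leO : rel O) (D : {pred O}).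
Notation X := (letter D).

Definition ltO (x y : O) : bool := (x != y) && leO x y.

Definition orig (x : X) : O := match x with inl y => y | inr y => val y end.

Definition is_mirror (x : X) : bool := if x is inr _ then true else false.

Definition lt_letter (x y : X) : Prop :=
  ltO (orig x) (orig y) \/ [/\ orig x = orig y, ~~ is_mirror x & is_mirror y].

Definition lt_lex (a b : seq X) : Prop :=
  (exists y c, b = a ++ y :: c) \/
  (exists c x d y e, [/\ a = c ++ x :: d, b = c ++ y :: e & lt_letter x y]).

Definition lt_red (a b : seq X) : Prop :=
  match a, b with
  | [::], [::] => False
  | [::], _ :: _ => True
  | _ :: _, [::] => False
  | x :: _, y :: _ =>
      ltO (orig x) (orig y) \/
      (orig x = orig y /\
       ((size a < size b)%N \/ (size a = size b /\ lt_lex a b)))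
  end.

Context (k : fieldType).

(* The free algebra k<X> is the algebra of the free monoid {fmonom X}. *)
Notation free_alg := {malg k[{fmonom X}]}.

Definition gen (x : X) : free_alg := mkmalgU (fmu x) 1.

Definition is_leading_word (f : free_alg) (a : {fmonom X}) : Prop :=
  a \in msupp f /\ forall b, b \in msupp f -> b != a -> lt_red b a.

Definition reducible (I : set free_alg) (a : {fmonom X}) : Prop :=
  exists f, [/\ f != 0, I f & is_leading_word f a].

Definition irreducible_letters (I : set free_alg) : set X :=
  [set x | ~ reducible I (fmu x)].

Context (H : algType k) (fX : X -> H).

Definition word_eval (a : {fmonom X}) : H := \prod_(x <- a) fX x.

Fact word_eval_is_mmorphism : mmorphism word_eval.
Proof.
split=> [a b|]; first by rewrite /word_eval fmM big_cat.
by rewrite /word_eval fm1 big_nil.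
Qed.

HB.instance Definition _ :=
  monalg.isMultiplicative.Build {fmonom X} H word_eval word_eval_is_mmorphism.

Definition proj (f : free_alg) : H := mmap (in_alg H) word_eval f.

Lemma proj_gen x : proj (gen x) = fX x.
Proof. by rewrite /proj /gen mmapU /= scale1r mul1r /word_eval fmU big_seq1. Qed.

Lemma proj_is_linear : linear proj.
Proof. by move=> a f g; rewrite /proj mmapD mmapZ /= mulr_algl. Qed.

Lemma proj_is_monoid_morphism : monoid_morphism proj.
Proof.
split; first exact: mmap1.
have comm_alg (f : free_alg) m m' : GRing.comm (in_alg H f@_m) (word_eval m').
  by rewrite /GRing.comm /= mulr_algl mulr_algr.
by have [projM _] := commr_mmap_is_multiplicative comm_alg.
Qed.

Definition ker_proj : set free_alg := [set f | proj f = 0].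

End Words.

(* Main.v *)
Require Import Defs.
From HB Require Import structures.
From mathcomp Require Import all_boot all_algebra.
From mathcomp Require Import finmap.
From mathcomp.multinomials Require Import monalg.
From mathcomp Require Import boolp classical_sets wochoice.

(* For a subalgebra K which is a left coideal and in which group-likes are
   invertible, an element x outside K with D(x) in g (x) x + H (x) K, where D is
   the comultiplication of H and g is
   group-like, is never in K + K^+ H.  Indeed, if F is a left coideal and a left
   K-submodule, and y outside F satisfies D(y) in g (x) y + H (x) F, then Ky is
   free of rank one modulo F, because the annihilator of y modulo F is a left
   ideal and a left coideal of K, and a nonzero left coideal contains a
   group-like.  As H is pointed and comodules are locally finite, such a y
   exists as long as F <> H, so H is exhausted from K + Kx by free K-modules.

   For (a), filter H by iterated semi-invariants x of this kind, take the
   elements x - eps(x) as letters, and let the group-likes come first, with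
   their inverses as mirrors: a reducible letter lies in k + K^+ H (plus a
   multiple of g for the mirror of g), where K is generated by the smaller
   letters, hence in the algebra generated by the letters before it.  For (b), a
   strictly increasing chain of finitely generated K yields a strictly increasing
   chain of right ideals K^+ H; left ideals are handled by the opposite
   co-opposite of H. *)

Set Implicit Arguments.
Unset Strict Implicit.
Unset Printing Implicit Defensive.
Import GRing.Theory.
Local Open Scope ring_scope.
Local Open Scope classical_set_scope.

(** * Zorn's lemma above a given set *)

(** [Zorn_bigcup] also asks about the empty chain. It is applied to the sets whose union with F
    satisfies P, so that every chain, the empty one included, becomes a chain containing F. *)
Lemma Zorn_above (T : Type) (P : set (set T)) (F : set T) : P F ->
    (forall C : set (set T), total_on C subset -> C F -> C `<=` P ->
       P (\bigcup_(X in C) X)) ->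
  exists A, [/\ P A, F `<=` A & forall B, P B -> A `<=` B -> B `<=` A].
Proof.
move=> PF Pchain.
have [|A [PA maxA]] := @Zorn_bigcup T [set A | P (F `|` A)].
  move=> C CP Cchain /=.
  pose C' := [set X | X = F \/ exists2 Y, C Y & X = F `|` Y].
  have -> : F `|` \bigcup_(X in C) X = \bigcup_(X in C') X.
    apply/seteqP; split=> [x [Fx | [Y CY Yx]] | x [Y [-> | [Z CZ ->]]]].
    - by exists F => //; left.
    - by exists (F `|` Y); [right; exists Y | right].
    - by left.
    - by case=> [Fx | Zx]; [left | right; exists Z].
  apply: Pchain; last 2 first.
  - by left.
  - by move=> X [-> // | [Y CY ->]]; exact: CP.
  move=> X Y [-> | [X' CX ->]] [-> | [Y' CY ->]].
  - by left.
  - by left=> x; left.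
  - by right=> x; left.
  - by have [le | le] := Cchain _ _ CX CY; [left | right]; exact: setUS.
exists (F `|` A); split=> // B PB AB x Bx; apply: contrapT => nAx.
have FB : F `|` B = B by apply/setUidPr => y Fy; apply: AB; left.
apply: (maxA B); last by rewrite /= FB.
by split=> [y Ay | BA]; [apply: AB; right | apply: nAx; right; exact: BA].
Qed.

(** * Subspaces, finite extensions and separating functionals *)

Section Subspaces.
Context (k : fieldType) (V : lmodType k).
Implicit Types (E F : set V) (s : seq V).

Definition mk_scalar (f : V -> k) (fl : scalar f) : {scalar V} :=
  HB.pack f (GRing.isLinear.Build k V k *%R f fl).

Lemma subspaceP F :
  subspace F <-> F 0 /\ forall a u v, F u -> F v -> F (a *: u + v).
Proof.
rewrite /subspace /= /GRing.submod_closed /GRing.linear_closed.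
split=> -[F0 FD]; split; rewrite ?inE // in F0 *.
  by move=> a u v Fu Fv; have := FD a u v; rewrite !inE; apply.
by move=> a u v; rewrite !inE; exact: FD.
Qed.

Section SubspaceTheory.
Variables (F : set V) (Fsub : subspace F).

Lemma subspace0 : F 0. Proof. by have /subspaceP[] := Fsub. Qed.

Lemma subspaceZD a u v : F u -> F v -> F (a *: u + v).
Proof. by have /subspaceP[_] := Fsub; apply. Qed.

Lemma subspaceD u v : F u -> F v -> F (u + v).
Proof. by rewrite -[u in F (u + v)]scale1r; exact: subspaceZD. Qed.

Lemma subspaceZ a u : F u -> F (a *: u).
Proof.
by move=> Fu; rewrite -[_ *: _]addr0; apply: subspaceZD => //; exact: subspace0.
Qed.

Lemma subspaceB u v : F u -> F v -> F (u - v).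
Proof. by move=> Fu Fv; rewrite addrC -scaleN1r; exact: subspaceZD. Qed.

Lemma subspaceBr u v : F v -> F (u - v) -> F u.
Proof. by move=> Fv Fuv; rewrite -(subrK v u); exact: subspaceD. Qed.

Lemma subspace_sum (I : eqType) (r : seq I) (f : I -> V) :
  (forall i, i \in r -> F (f i)) -> F (\sum_(i <- r) f i).
Proof.
by move=> Ff; rewrite big_seq; apply: big_ind Ff; [exact: subspace0 | exact: subspaceD].
Qed.

End SubspaceTheory.

Lemma subspace_set0 : subspace [set (0 : V)].
Proof. by apply/subspaceP; split=> // a x y -> ->; rewrite scaler0 addr0. Qed.

Lemma lspan_subspace (S : set V) : subspace (lspan S).
Proof.
apply/subspaceP; split=> [E [Esub _] | a u v Su Sv E ES]; first exact: subspace0.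
by apply: subspaceZD; [have [] := ES | apply: Su | apply: Sv].
Qed.

Lemma lspan_sub (S E : set V) : subspace E -> S `<=` E -> lspan S `<=` E.
Proof. exact: smallest_sub. Qed.

Lemma sub_lspan (S : set V) : S `<=` lspan S.
Proof. exact: sub_smallest. Qed.

(* The subspace F + span s. *)
Fixpoint adjoin F s : set V :=
  if s is b :: s' then [set v | exists c, adjoin F s' (v - c *: b)] else F.

Lemma adjoin_subspace F s : subspace F -> subspace (adjoin F s).
Proof.
move=> Fsub; elim: s => //= b s IH; apply/subspaceP; split.
  by exists 0; rewrite scale0r subr0; exact: subspace0.
move=> a u v [c Fu] [d Fv]; exists (a * c + d).
have -> : a *: u + v - (a * c + d) *: b = a *: (u - c *: b) + (v - d *: b).
  by rewrite scalerDl -scalerA scalerBr opprD addrACA.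
exact: subspaceZD.
Qed.

Lemma sub_adjoin F s : F `<=` adjoin F s.
Proof. by elim: s => //= b s IH v /IH Fv; exists 0; rewrite scale0r subr0. Qed.

Lemma mem_adjoin F s b : subspace F -> b \in s -> adjoin F s b.
Proof.
move=> Fsub; elim: s => //= a s IH; rewrite inE => /predU1P[-> | /IH Fb].
  by exists 1; rewrite scale1r subrr; apply: sub_adjoin; exact: subspace0.
by exists 0; rewrite scale0r subr0.
Qed.

Lemma adjoin_sub F E s :
  subspace E -> F `<=` E -> {in s, forall b, E b} -> adjoin F s `<=` E.
Proof.
move=> Esub FE; elim: s => //= b s IH Es v [c Fv].
apply: (subspaceBr Esub (subspaceZ Esub c (Es b (mem_head _ _)))).
by apply: IH Fv => a sa; apply: Es; rewrite inE sa orbT.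
Qed.

(** Steinitz exchange in place of dimensions: unless E already lies over the tail of s, some v in E
    has a nonzero coefficient c along the head b. Then v replaces b, and the induction continues
    with the part of E over the tail, which misses w shifted by a multiple of v. *)
Lemma adjoin_exchange F E s w : subspace F -> subspace E -> F `<=` E ->
    E `<=` adjoin F s -> adjoin F s w -> ~ E w ->
  exists2 t, (size t < size s)%N & E `<=` adjoin F t.
Proof.
move=> Fsub; elim: s E w => [|b s IH] E w Esub FE Es /= sw nEw.
  by case: nEw; apply: FE.
have [Es' | /existsNP[v /not_implyP[Ev nsv]]] := pselect (E `<=` adjoin F s).
  by exists s.
have Ssub : subspace (adjoin F s) by exact: adjoin_subspace Fsub.
have [c vc] := Es v Ev.
have c0 : c != 0 by apply: contra_not_neq nsv => c0; rewrite c0 scale0r subr0 in vc.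
have shift u d : adjoin F s (u - d *: b) -> adjoin F s (u - (d / c) *: v).
  move=> ud; have -> : u - (d / c) *: v = (u - d *: b) - (d / c) *: (v - c *: b).
    by rewrite scalerBr scalerA divfK // opprB addrA subrK.
  by apply: subspaceB => //; apply: subspaceZ.
have [d wd] := sw.
have [|||||t tlt Et] := IH (E `&` adjoin F s) (w - (d / c) *: v).
- apply/subspaceP; split=> [|a x y [Ex sx] [Ey sy]]; first by split; exact: subspace0.
  by split; exact: subspaceZD.
- by move=> u Fu; split; [exact: FE | exact: sub_adjoin].
- by move=> u [].
- exact: shift.
- by case=> Ew _; apply: nEw; apply: (subspaceBr Esub _ Ew); exact: subspaceZ.
exists (v :: t) => // u Eu; have [e ue] := Es u Eu.
exists (e / c); apply: Et; split; last exact: shift.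
by apply: subspaceB => //; exact: subspaceZ.
Qed.

(** Induction on the number of vectors spanning E over F: by [adjoin_exchange], a set satisfying P
    strictly between F and E needs fewer of them. P will be the left coideals or the
    subcoalgebras. *)
Lemma minimal_subspace F (P : set (set V)) E s : subspace F ->
    (forall W, P W -> subspace W) -> P E -> F `<=` E -> E `<=` adjoin F s ->
    (exists2 z, E z & ~ F z) ->
  exists M, [/\ P M, F `<=` M, M `<=` E, exists2 z, M z & ~ F z &
    forall W, P W -> F `<=` W -> W `<=` M -> W `<=` F \/ M `<=` W].
Proof.
move=> Fsub Psub; have [n] := ubnP (size s).
elim: n E s => // n IH E s; rewrite ltnS => sn PE FE Es Ez.
have [[W [PW FW WE WF EW]] | minE] := pselect (exists W,
  [/\ P W, F `<=` W, W `<=` E, ~ W `<=` F & ~ E `<=` W]); last first.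
  exists E; split=> // W PW FW WE.
  have [WF | nWF] := pselect (W `<=` F); first by left.
  by right; apply: contrapT => nEW; apply: minE; exists W.
have /existsNP[w /not_implyP[Ew nWw]] := EW.
have [t ts Wt] := adjoin_exchange Fsub (Psub _ PW) FW (subset_trans WE Es) (Es _ Ew) nWw.
have [||M [PM FM MW Mz Mmin]] := IH W t _ PW FW Wt.
- exact: leq_trans ts sn.
- by have /existsNP[y /not_implyP[Wy nFy]] := WF; exists y.
by exists M; split=> //; exact: subset_trans WE.
Qed.

(** A subspace E maximal among those containing F and avoiding v is a complement of the line through
    v; the functional reads off the coefficient of v modulo E. *)
Lemma functional_separation F v : subspace F -> ~ F v ->
  exists f : {scalar V}, (forall u, F u -> f u = 0) /\ f v = 1.
Proof.
move=> Fsub nFv.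
have [||E [[Esub nEv] FE maxE]] :=
    @Zorn_above V [set E | subspace E /\ ~ E v] F; first by [].
  move=> C Cchain CF CP; split; last by case=> X /CP[_ nXv].
  apply/subspaceP; split; first by exists F => //; exact: subspace0.
  move=> a x y [X CX Xx] [Y CY Yy].
  have [XY | YX] := Cchain _ _ CX CY.
    by exists Y => //; apply: subspaceZD (CP Y CY).1 _ _ _ _ Yy; exact: XY.
  by exists X => //; apply: subspaceZD (CP X CX).1 _ _ _ Xx _; exact: YX.
(* If u were not a multiple of v modulo E, adjoining u to E would still avoid v, against
   maximality. *)
have coord u : {c | E (u - c *: v)}.
  apply: cid; have [Eu | nEu] := pselect (E u).
    by exists 0; rewrite scale0r subr0.
  apply: contrapT => nu; apply: nEu; apply: (maxE (adjoin E [:: u])); last 2 first.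
  - exact: sub_adjoin.
  - by exists 1; rewrite scale1r subrr; exact: subspace0.
  split; first exact: adjoin_subspace.
  case=> c Evu; apply: nu; have [c0 | c0] := eqVneq c 0.
    by case: nEv; rewrite c0 scale0r subr0 in Evu.
  exists c^-1; have -> : u - c^-1 *: v = - c^-1 *: (v - c *: u).
    by rewrite scaleNr scalerBr opprB scalerA mulVf // scale1r.
  exact: subspaceZ.
have coordE u c : E (u - c *: v) -> sval (coord u) = c.
  move=> Ec; apply: contrapT => /eqP; rewrite -subr_eq0 => nz; apply: nEv.
  have := subspaceB Esub Ec (svalP (coord u)).
  rewrite opprB addrC addrA subrK -scalerBl.
  by move=> /(subspaceZ Esub (sval (coord u) - c)^-1); rewrite scalerA mulVf // scale1r.
have lin : scalar (fun u => sval (coord u)).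
  move=> a x y; apply: coordE.
  rewrite scalerDl -scalerA opprD addrACA -scalerBr.
  by apply: subspaceZD => //; [exact: (svalP (coord x)) | exact: (svalP (coord y))].
exists (mk_scalar lin); split=> [u Fu | ]; apply: coordE.
  by rewrite scale0r subr0; exact: FE.
by rewrite scale1r subrr; exact: subspace0.
Qed.

Lemma functional_eq (u v : V) : (forall f : {scalar V}, f u = f v) -> u = v.
Proof.
move=> fuv; apply: contrapT => uv.
have [||f [_]] := @functional_separation [set 0] (u - v).
- exact: subspace_set0.
- by move=> /eqP; rewrite subr_eq0 => /eqP.
by rewrite linearB fuv subrr => /eqP; rewrite eq_sym oner_eq0.
Qed.

End Subspaces.

Lemma lspan_adjoin (k : fieldType) (V : lmodType k) (S : set V) v : lspan S v ->
  exists2 s : seq V, {in s, forall b, S b} & adjoin [set 0] s v.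
Proof.
have sub0 := subspace_set0 V.
pose E := [set w | exists2 s : seq V, {in s, forall b, S b} & adjoin [set 0] s w].
move=> Sv; suff: E v by [].
apply: (lspan_sub _ _ Sv) => [|w Sw]; last first.
  exists [:: w]; first by move=> b; rewrite inE => /eqP->.
  by apply: mem_adjoin; rewrite ?mem_head.
apply/subspaceP; split; first by exists [::].
move=> a x y [s sS sx] [t tS ty]; exists (s ++ t).
  by move=> b; rewrite mem_cat => /orP[/sS | /tS].
have stsub : subspace (adjoin [set 0] (s ++ t)) by exact: adjoin_subspace.
apply: subspaceZD => //.
  apply: (adjoin_sub stsub _ _ sx) => [_ -> | b sb]; first exact: subspace0.
  by apply: mem_adjoin; rewrite // mem_cat sb.
apply: (adjoin_sub stsub _ _ ty) => [_ -> | b tb]; first exact: subspace0.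
by apply: mem_adjoin; rewrite // mem_cat tb orbT.
Qed.

(* Shortest linear combinations: if e = c g + ... is not an eigenvector for g,
   then L f e - f(g) e is a nonzero element of E with fewer terms. *)
Lemma glike_in_span (k : fieldType) (V : lmodType k)
    (L : {scalar V} -> V -> V) (eps : {scalar V}) (N E : set V) :
  (forall f, linear (L f)) -> (forall f x, eps (L f x) = f x) ->
  (forall g, N g -> forall f, L f g = f g *: g) ->
  subspace E -> (forall f x, E x -> E (L f x)) -> E `<=` lspan N ->
  (exists2 z, E z & z <> 0) -> exists2 g, N g & E g.
Proof.
move=> Llin epsL NL Esub EL EN [z Ez z0]; have [s sN sz] := lspan_adjoin (EN _ Ez).
have L0 f : L f 0 = 0.
  by have := Llin f (-1) 0 0; rewrite scaler0 addr0 scaleN1r addNr.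
have sub0 := subspace_set0 V.
elim: s z sN Ez z0 sz => [//|g s IH] z sN Ez z0 [c zc].
have Ng : N g by apply: sN; exact: mem_head.
have {}sN : {in s, forall b, N b} by move=> b sb; apply: sN; rewrite inE sb orbT.
(* If z behaves like g under every [L f], then z is [eps z *: g], so g itself lies in E. *)
have [Lz | /existsNP[f Lz]] := pselect (forall f, L f z = f g *: z).
  have zE : z = eps z *: g.
    by apply: functional_eq => f; rewrite -epsL Lz !linearZ /= mulrC.
  have ez : eps z != 0 by apply/eqP => ez; apply: z0; rewrite zE ez scale0r.
  exists g => //; rewrite -[g]scale1r -(mulVf ez) -scalerA -zE.
  exact: subspaceZ.
apply: (IH (L f z - f g *: z)) => //.
- by apply: subspaceB => //; [exact: EL | exact: subspaceZ].
- by move=> /eqP; rewrite subr_eq0 => /eqP.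
have ssub : subspace (adjoin [set 0] s) by exact: adjoin_subspace.
have sL : adjoin [set 0] s `<=` [set x | adjoin [set 0] s (L f x)].
  apply: adjoin_sub => [|_ -> | b sb] /=.
  - apply/subspaceP; split=> [|a x y sx sy] /=; first by rewrite L0; exact: subspace0.
    by rewrite Llin; exact: subspaceZD.
  - by rewrite L0; exact: subspace0.
  - by rewrite NL; [apply: subspaceZ => //; exact: mem_adjoin | exact: sN].
(* The head term [c *: g] cancels because g is an eigenvector, so only terms from the tail s
   remain. *)
have -> : L f z - f g *: z = L f (z - c *: g) - f g *: (z - c *: g).
  have -> : L f (z - c *: g) = L f z - c *: (f g *: g).
    by rewrite addrC -scaleNr Llin NL // scaleNr addrC.
  by rewrite scalerBr opprB !scalerA [f g * c]mulrC addrA subrK.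
by apply: subspaceB => //; [exact: sL | exact: subspaceZ].
Qed.

(** * Contracting one leg of a tensor with a functional *)

Section TensorSlices.
Context (k : fieldType) (V W : lmodType k).
Implicit Types (t : tensor V W) (f : {scalar V}) (E : set W).

Definition lslice f t : W := tlift (fun v w => f v *: w) t.

Definition rslice (f : {scalar W}) t : V := tlift (fun v w => f w *: v) t.

Lemma lslice_class f s : lslice f (tens_class s) = \sum_(p <- s) f p.1 *: p.2.
Proof.
apply: tlift_class => [w a x y | v a x y].
  by rewrite linearP scalerDl scalerA.
by rewrite scalerDr !scalerA mulrC.
Qed.

Lemma rslice_class (f : {scalar W}) s :
  rslice f (tens_class s) = \sum_(p <- s) f p.2 *: p.1.
Proof.
apply: tlift_class => [w a x y | v a x y].
  by rewrite scalerDr !scalerA mulrC.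
by rewrite linearP scalerDl scalerA.
Qed.

(** If a is the sum of the [c_i *: a_i] over the first legs a_i of s, then bilinearity moves
    [tens a b] into s by adding [c_i *: b] to the i-th second leg. *)
Lemma tens_absorb a b (s : seq (V * W)) : adjoin [set 0] (unzip1 s) a ->
  exists2 s', unzip1 s' = unzip1 s & tens a b + tens_class s = tens_class s'.
Proof.
elim: s a => [|[a1 b1] s IH] a /=.
  move=> ->; exists [::] => //; rewrite addrC.
  have := tens_is_linear_l b (-1) 0 (0 : V).
  by rewrite scaler0 addr0 scaleN1r addNr => ->; rewrite addr0.
move=> [c /IH[s' ss' absorb]]; exists ((a1, c *: b + b1) :: s').
  by rewrite /= ss'.
have -> : tens a b = c *: tens a1 b + tens (a - c *: a1) b.
  by rewrite -tens_is_linear_l addrC subrK.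
rewrite -[(a1, b1) :: s]cat1s -[(a1, _) :: s']cat1s !tens_class_cat -absorb.
rewrite -[tens_class [:: (a1, _ + _)]]/(tens _ _) tens_is_linear_r.
by rewrite -!addrA; congr (_ + _); rewrite addrCA.
Qed.

(** A first leg depending on the later ones is removed by [tens_absorb]; otherwise a functional that
    is 1 on it and 0 on the later ones exhibits its second leg as a slice, hence in E. Keeping the
    first legs among the old ones allows a second application to the other side. *)
Lemma tensor_support E (s : seq (V * W)) :
    subspace E -> (forall f, E (lslice f (tens_class s))) ->
  exists s', [/\ tens_class s = tens_class s', {in s', forall p, E p.2} &
    {subset unzip1 s' <= unzip1 s}].
Proof.
move=> Esub; have [n] := ubnP (size s); elim: n s => // n IH [|[a b] s] /=.
  by exists [::].
rewrite ltnS => sn sE; have [/(tens_absorb b)[s' ss' absorb] | na] :=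
  pselect (adjoin [set 0] (unzip1 s) a).
  have eq_s : tens_class ((a, b) :: s) = tens_class s'.
    by rewrite -absorb -cat1s tens_class_cat.
  have [||s'' [eq_s' s''E sub]] := IH s'.
  - by rewrite -(size_map fst) -/(unzip1 _) ss' size_map.
  - by move=> f; rewrite -eq_s.
  exists s''; split=> //; first by rewrite eq_s.
  by move=> x /sub; rewrite ss' inE orbC => ->.
have [|f [f0 fa]] := functional_separation _ na.
  exact/adjoin_subspace/subspace_set0.
have Eb : E b.
  have := sE f; rewrite lslice_class big_cons /= fa scale1r big1_seq ?addr0 //.
  move=> p /= sp; rewrite f0 ?scale0r //; apply: mem_adjoin; last exact: map_f.
  exact: subspace_set0.
have [||s' [ss' s'E sub]] := IH s; first exact: sn.
  move=> h; apply: (subspaceBr Esub (v := - (h a *: b))).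
    by rewrite -scaleNr; exact: subspaceZ.
  by have := sE h; rewrite !lslice_class big_cons opprK addrC.
exists ((a, b) :: s'); split.
- by rewrite -[_ :: s]cat1s -[_ :: s']cat1s !tens_class_cat ss'.
- by move=> p; rewrite inE => /predU1P[-> | /s'E].
by move=> x; rewrite !inE => /predU1P[-> | /sub->]; rewrite ?eqxx ?orbT.
Qed.

Lemma lslice_is_linear f : linear (lslice f).
Proof.
apply: tlift_is_linear => [w a x y | v a x y].
  by rewrite linearP scalerDl scalerA.
by rewrite scalerDr !scalerA mulrC.
Qed.

Lemma rslice_is_linear (f : {scalar W}) : linear (rslice f).
Proof.
apply: tlift_is_linear => [w a x y | v a x y].
  by rewrite scalerDr !scalerA mulrC.
by rewrite linearP scalerDl scalerA.
Qed.

HB.instance Definition _ f :=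
  GRing.isLinear.Build k (tensor V W) W *:%R (lslice f) (lslice_is_linear f).

HB.instance Definition _ (f : {scalar W}) :=
  GRing.isLinear.Build k (tensor V W) V *:%R (rslice f) (rslice_is_linear f).

Lemma lslice_rslice f (g : {scalar W}) t : g (lslice f t) = f (rslice g t).
Proof.
rewrite -(tens_repr t) lslice_class rslice_class !linear_sum.
by apply: eq_bigr => p _; rewrite !linearZ /= mulrC.
Qed.

(** The case of the zero subspace in [tensor_support]: all second legs of the difference can be
    taken to be 0. *)
Lemma lslice_inj t u : (forall f, lslice f t = lslice f u) -> t = u.
Proof.
move=> tu; apply/eqP; rewrite -subr_eq0 -(tens_repr (t - u)).
have [|f|s [-> s0 _]] := @tensor_support [set 0] (repr (t - u)).
- exact: subspace_set0.
- rewrite tens_repr addrC -scaleN1r lslice_is_linear tu scaleN1r addNr.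
  by [].
rewrite tens_classE big1_seq // => p /= /s0 ->.
have := tens_is_linear_r p.1 (-1) 0 (0 : W).
by rewrite scaler0 addr0 scaleN1r addNr.
Qed.

Lemma rslice_inj t u : (forall f : {scalar W}, rslice f t = rslice f u) -> t = u.
Proof.
move=> tu; apply: lslice_inj => f; apply: functional_eq => g.
by rewrite !lslice_rslice tu.
Qed.

End TensorSlices.

(** * Induction along a well order, and the lexicographic order on levels *)

Lemma wo_induction (T : choiceType) (le : rel T) (Q : T -> Prop) : well_order le ->
  (forall x, (forall y, ltO le y x -> Q y) -> Q x) -> forall x, Q x.
Proof.
move=> wo_le IH x; apply: contrapT => nQx.
have /wo_le[m [[/asboolP nQm minm] _]] : nonempty [pred y | `[< ~ Q y >]].
  by exists x; apply/asboolP.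
have le_anti : antisymmetric le := in2T (wo_chain_antisymmetric (withinW wo_le)).
apply: nQm; apply: IH => y /andP[ym le_ym]; apply: contrapT => nQy.
case/eqP: ym; apply: le_anti; rewrite le_ym minm //; exact/asboolP.
Qed.

Section LexicographicNat.
Context (T : choiceType) (W : rel T) (wo_W : well_order W).

Definition nat_lexi : rel (nat * T) :=
  fun x y => (x.1 < y.1)%N || ((x.1 == y.1) && W x.2 y.2).

Lemma nat_lexi_wo : well_order nat_lexi.
Proof.
have Wanti : antisymmetric W := in2T (wo_chain_antisymmetric (withinW wo_W)).
apply: antisymmetric_well_order => [[m x] [n y] | S [[n x] Sx]].
  rewrite /nat_lexi /= => /andP[/orP[mn | /andP[/eqP-> xy]] /orP[nm | /andP[/eqP nm yx]]].
  - by have := ltn_trans mn nm; rewrite ltnn.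
  - by rewrite nm ltnn in mn.
  - by rewrite ltnn in nm.
  by congr (_, _); apply: Wanti; rewrite xy.
have exn : exists n, `[< exists x, (n, x) \in S >] by exists n; apply/asboolP; exists x.
have [m /asboolP[y Sy] mmin] := ex_minnP exn.
have /wo_W[z [[Sz zmin] _]] : nonempty [pred z | (m, z) \in S] by exists y.
exists (m, z); split=> // -[j w] Sw; rewrite /nat_lexi /=.
have /mmin : `[< exists x, (j, x) \in S >] by apply/asboolP; exists w.
rewrite leq_eqVlt => /orP[/eqP mj | -> //].
by rewrite mj ltnn eqxx /=; apply: zmin; rewrite /in_mem /= mj.
Qed.

End LexicographicNat.

Notation alg S := (smallest (@subalgebra _ _) S).

(** * Generated subalgebras *)

Section Subalgebras.
Context (k : fieldType) (A : algType k).
Implicit Types (B S : set A).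

Lemma subalgebraP B :
  subalgebra B <-> [/\ B 1, subspace B & forall x y, B x -> B y -> B (x * y)].
Proof.
rewrite /subalgebra /= /GRing.subalg_closed; split=> [[B1 Blin BM] | [B1 Bsub BM]].
  split; first by rewrite inE in B1.
    have lin a u v : B u -> B v -> B (a *: u + v).
      by move=> Bu Bv; have := Blin a u v; rewrite !inE; apply.
    rewrite inE in B1; apply/subspaceP; split=> //.
    (* Closure is only given for 1 and for linear combinations, so 0 is obtained as -1 + 1. *)
    by rewrite -(addNr 1) -scaleN1r; exact: lin.
  by move=> x y Bx By; have := BM x y; rewrite !inE; apply.
split; first by rewrite inE.
  by move=> a u v; rewrite !inE; exact: subspaceZD.
by move=> x y; rewrite !inE; exact: BM.
Qed.

Lemma sub_alg S : S `<=` alg S.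
Proof. exact: sub_smallest. Qed.

Lemma alg_sub S B : subalgebra B -> S `<=` B -> alg S `<=` B.
Proof. exact: smallest_sub. Qed.

Lemma alg_subalgebra S : subalgebra (alg S).
Proof.
apply/subalgebraP; split=> [B [/subalgebraP[] //] | | x y Sx Sy B [Balg BS]].
  apply/subspaceP; split=> [B [/subalgebraP[_ /subspaceP[]]] // | a u v Su Sv B SB].
  have [/subalgebraP[_ Bsub _] _] := SB.
  by apply: subspaceZD => //; [apply: Su | apply: Sv].
by have /subalgebraP[_ _ BM] := Balg; apply: BM; [apply: Sx | apply: Sy].
Qed.

Lemma alg_subspace S : subspace (alg S).
Proof. by have /subalgebraP[] := alg_subalgebra S. Qed.

Lemma alg1 S : alg S 1.
Proof. by have /subalgebraP[] := alg_subalgebra S. Qed.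

Lemma algM S x y : alg S x -> alg S y -> alg S (x * y).
Proof. by have /subalgebraP[_ _] := alg_subalgebra S; apply. Qed.

Lemma algC S (a : k) : alg S a%:A.
Proof. exact: (subspaceZ (@alg_subspace S) a (@alg1 S)). Qed.

(** Lets a generator x be traded for x - eps(x). *)
Lemma alg_shift S (a : k) x : alg S (x - a%:A) -> alg S x.
Proof. exact: (subspaceBr (@alg_subspace S) (@algC S a)). Qed.

End Subalgebras.

(** * Coalgebras seen through the slices of their comultiplication *)

Section Slices.
Context (k : fieldType) (A : algType k) (L R : {scalar A} -> A -> A).
Context (eps : {scalar A}) (inv : A -> A).

Fact mull_functional_is_scalar (f : {scalar A}) (a : A) : scalar (fun x => f (a * x)).
Proof. by move=> c x y; rewrite mulrDr -scalerAr linearP. Qed.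

Definition mull_functional f a := mk_scalar (mull_functional_is_scalar f a).

(** Stands for D(x) being the sum of the p.1 (x) p.2: a tensor is determined by its slices, so no
    tensor product has to be mentioned. *)
Definition represents (x : A) (s : seq (A * A)) : Prop :=
  forall f, L f x = \sum_(p <- s) f p.1 *: p.2.

Definition glike : set A := [set g | (forall f, L f g = f g *: g) /\ eps g = 1].

(** Stability on both sides amounts to D(C) lying in C (x) C, by [tensor_support] applied to each
    leg. *)
Definition subcoalg (C : set A) : Prop := [/\ subspace C,
  forall f x, C x -> C (L f x) & forall f x, C x -> C (R f x)].

(* A coalgebra presented by the slices L f x = f(x_1) x_2 and R f x = x_1 f(x_2)
   of its comultiplication; exchanging L and R gives the co-opposite. *)
Record coalgebra_slices : Prop := CoalgebraSlices {
  sliceL_linear : forall f, linear (L f);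
  sliceR_linear : forall f, linear (R f);
  slice_dual : forall (f g : {scalar A}) x, g (L f x) = f (R g x);
  sliceLR : forall f g x, L f (R g x) = R g (L f x);
  sliceL_counit : forall x, L eps x = x;
  sliceR_counit : forall x, R eps x = x;
  sliceL_finite : forall x, exists s, represents x s
}.

(* The algebra structure; the last field is where pointedness enters. *)
Record pointed_slices : Prop := PointedSlices {
  sliceL1 : forall f, L f 1 = f 1 *: 1;
  sliceLM : forall f x s y, represents x s ->
    L f (x * y) = \sum_(p <- s) p.2 * L (mull_functional f p.1) y;
  eps1 : eps 1 = 1;
  epsM : forall x y, eps (x * y) = eps x * eps y;
  glikeV : forall g, glike g -> inv g * g = 1 /\ g * inv g = 1;
  subcoalgebra_glike : forall C : set A, subcoalg C ->
    (exists2 x, C x & x <> 0) -> exists2 g, glike g & C g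
}.

Hypothesis slices : coalgebra_slices.
Implicit Types (f phi psi : {scalar A}) (g : A) (E F K N S : set A).

(** Stability under all f(x_1) x_2 expresses that D(F) lies in A (x) F. *)
Definition left_coideal : set (set A) :=
  [set F | subspace F /\ forall f x, F x -> F (L f x)].

Lemma sliceLD f x y : L f (x + y) = L f x + L f y.
Proof. by have := sliceL_linear slices f 1 x y; rewrite !scale1r. Qed.

Lemma sliceL0 f : L f 0 = 0.
Proof.
by have := sliceL_linear slices f (-1) 0 0; rewrite scaler0 addr0 scaleN1r addNr.
Qed.

Lemma sliceLZ f a x : L f (a *: x) = a *: L f x.
Proof. by have := sliceL_linear slices f a x 0; rewrite !addr0 sliceL0 addr0. Qed.

Lemma sliceLB f x y : L f (x - y) = L f x - L f y.
Proof. by rewrite -scaleN1r sliceLD sliceLZ scaleN1r. Qed.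

Lemma sliceRB f x y : R f (x - y) = R f x - R f y.
Proof.
have := sliceR_linear slices f (-1) y x.
by rewrite !scaleN1r ![- _ + _]addrC.
Qed.

Fact sliceL_functional_is_scalar f psi : scalar (fun x => f (L psi x)).
Proof. by move=> a x y; rewrite (sliceL_linear slices) linearP. Qed.

Fact sliceR_functional_is_scalar f psi : scalar (fun x => f (R psi x)).
Proof. by move=> a x y; rewrite (sliceR_linear slices) linearP. Qed.

(** Coassociativity, obtained from duality and the commutation of left with right slices: a slice of
    a slice is a slice, for the convolution of the two functionals. *)
Lemma sliceLL f psi x :
  L psi (L f x) = L (mk_scalar (sliceR_functional_is_scalar f psi)) x.
Proof.
apply: functional_eq => h.
by rewrite !(slice_dual slices) /= -(sliceLR slices) (slice_dual slices).
Qed.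

Lemma sliceRR f psi x :
  R f (R psi x) = R (mk_scalar (sliceL_functional_is_scalar psi f)) x.
Proof.
apply: functional_eq => h.
by rewrite -!(slice_dual slices) /= (sliceLR slices) (slice_dual slices).
Qed.

Lemma sliceRZ f a x : R f (a *: x) = a *: R f x.
Proof.
have R0 : R f 0 = 0 by have := sliceRB f 0 0; rewrite !subrr.
by have := sliceR_linear slices f a x 0; rewrite !addr0 R0 addr0.
Qed.

Lemma sliceRD f x y : R f (x + y) = R f x + R f y.
Proof. by have := sliceR_linear slices f 1 x y; rewrite !scale1r. Qed.

Lemma left_coideal0 : left_coideal [set 0].
Proof.
split=> [|f x ->]; last by rewrite /= sliceL0.
by apply/subspaceP; split=> // a u v -> ->; rewrite scaler0 addr0.
Qed.

Lemma left_coidealT : left_coideal setT.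
Proof. by split=> //; apply/subspaceP; split. Qed.

Lemma sliceL_preim_subspace F : subspace F -> subspace [set x | forall f, F (L f x)].
Proof.
move=> Fsub; apply/subspaceP; split=> [f | a x y Fx Fy f].
  by rewrite sliceL0; exact: subspace0.
by rewrite (sliceL_linear slices); exact: subspaceZD.
Qed.

Lemma left_coideal_lspan S :
  (forall f x, S x -> lspan S (L f x)) -> left_coideal (lspan S).
Proof.
move=> SL; have Ssub := @lspan_subspace k A S; split=> // f x Sx.
apply: (lspan_sub (sliceL_preim_subspace Ssub)) Sx f.
by move=> y Sy f; exact: SL.
Qed.

(* Local finiteness: the left coideal generated by one element is finite
   dimensional. *)
Lemma minimal_left_coideal F N : left_coideal F -> left_coideal N -> F `<=` N ->
    (exists2 z, N z & ~ F z) ->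
  exists V, [/\ left_coideal V, F `<=` V, V `<=` N, exists2 z, V z & ~ F z &
    forall W, left_coideal W -> F `<=` W -> W `<=` V -> W `<=` F \/ V `<=` W].
Proof.
move=> [Fsub FL] [Nsub NL] FN [z Nz nFz].
have [s zs] := sliceL_finite slices z.
pose S := F `|` [set L f z | f in setT].
have Sz : S z by right; exists eps => //; exact: sliceL_counit.
have Ssub := @lspan_subspace k A S.
have [||||V [Vco FV VS Vz Vmin]] := @minimal_subspace k A F left_coideal
    (lspan S) [seq p.2 | p <- s] Fsub (fun E Eco => Eco.1).
- apply: left_coideal_lspan => f x [Fx | [psi _ <-]]; apply: sub_lspan.
    by left; exact: FL.
  by right; rewrite sliceLL; eexists.
- by move=> x Fx; apply: sub_lspan; left.
- apply: lspan_sub; first exact: adjoin_subspace.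
  move=> x [Fx | [f _ <-]]; first exact: sub_adjoin.
  rewrite (zs f); apply: subspace_sum => [|p sp]; first exact: adjoin_subspace.
  apply: subspaceZ; first exact: adjoin_subspace.
  by apply: mem_adjoin => //; apply: map_f.
- by exists z => //; exact: sub_lspan.
exists V; split=> //; apply: (subset_trans VS).
by apply: lspan_sub => // x [/FN // | [f _ <-]]; exact: NL.
Qed.

(** Local finiteness of coalgebras: the subcoalgebra generated by z is spanned by the middle legs
    [L f (R psi z)] of the iterated comultiplication, a finite-dimensional space, so
    [minimal_subspace] applies over 0. *)
Lemma minimal_subcoalgebra C : subcoalg C -> (exists2 z, C z & z <> 0) ->
  exists E, [/\ subcoalg E, E `<=` C, exists2 z, E z & z <> 0 &
    forall B, subcoalg B -> B `<=` E -> B `<=` [set 0] \/ E `<=` B].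
Proof.
move=> [Csub CL CR] [z Cz z0].
pose S := [set L f (R psi z) | f in setT & psi in setT].
have Ssub := @lspan_subspace k A S.
have Sz : S z.
  by exists eps => //; exists eps; rewrite // sliceL_counit ?sliceR_counit.
have sum0 : subspace [set (0 : A)] by exact: subspace_set0.
(* Each [R psi z] is a combination of the first legs p.1 of D(z); r collects the second legs of the
   D(p.1). *)
have [r zr] : exists r, lspan S `<=` adjoin [set 0] r.
  have [s zs] := sliceL_finite slices z.
  have [t zt] : exists t, forall p, p \in s -> forall f, adjoin [set 0] t (L f p.1).
    elim: s {zs} => [|p s [t zt]]; first by exists [::].
    have [u pu] := sliceL_finite slices p.1.
    exists ([seq q.2 | q <- u] ++ t) => q; rewrite inE => /predU1P[-> | sq] f.
      rewrite pu; apply: subspace_sum => [|a ua]; first exact: adjoin_subspace.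
      apply: subspaceZ; first exact: adjoin_subspace.
      by apply: mem_adjoin; rewrite // mem_cat map_f.
    apply: (adjoin_sub _ _ _ (zt q sq f)); first exact: adjoin_subspace.
      exact: sub_adjoin.
    by move=> b tb; apply: mem_adjoin; rewrite // mem_cat tb orbT.
  exists t; apply: lspan_sub; first exact: adjoin_subspace.
  move=> _ [f _ [psi _ <-]].
  have -> : R psi z = \sum_(p <- s) psi p.2 *: p.1.
    apply: functional_eq => h; rewrite -(slice_dual slices) zs !linear_sum /=.
    by apply: eq_bigr => p _; rewrite !linearZ /= mulrC.
  rewrite (big_morph (L f) (sliceLD f) (sliceL0 f)).
  apply: subspace_sum => [|p sp]; first exact: adjoin_subspace.
  by rewrite sliceLZ; apply: subspaceZ; [exact: adjoin_subspace | exact: zt].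
have [|||||E [Eco E0 ES Ez Emin]] := @minimal_subspace k A [set 0] subcoalg
    (lspan S) r sum0.
- by move=> E [].
- split=> // f x.
    apply: (lspan_sub (E := [set x | lspan S (L f x)])) => [|_ [h _ [psi _ <-]]].
      apply/subspaceP; split=> [|a u v Su Sv] /=.
        by rewrite sliceL0; exact: (subspace0 Ssub).
      by rewrite (sliceL_linear slices); exact: (subspaceZD Ssub).
    by rewrite /= sliceLL; apply: sub_lspan; eexists => //; exists psi.
  apply: (lspan_sub (E := [set x | lspan S (R f x)])) => [|_ [h _ [psi _ <-]]].
    apply/subspaceP; split=> [|a u v Su Sv] /=.
      by have := sliceRB f 0 0; rewrite !subrr => ->; exact: (subspace0 Ssub).
    by rewrite (sliceR_linear slices); exact: (subspaceZD Ssub).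
  rewrite /= -(sliceLR slices) sliceRR; apply: sub_lspan; exists h => //.
  by eexists.
- by move=> _ ->; exact: (subspace0 Ssub).
- exact: zr.
- by exists z; first exact: sub_lspan.
exists E; split=> //.
  apply: (subset_trans ES); apply: lspan_sub => // _ [f _ [psi _ <-]].
  exact/CL/CR.
by move=> B Bco BE; apply: Emin => // _ ->; case: Bco => /subspace0.
Qed.

(* The sum of the R phi (V) over phi in s, where every phi has to vanish on F. *)
Fixpoint coefficients (F V : set A) (s : seq {scalar A}) : set A :=
  if s is phi :: s' then
    [set c | (forall u, F u -> phi u = 0) /\
             exists2 v, V v & coefficients F V s' (c - R phi v)]
  else [set 0].

Section Coefficients.
Variables (F V : set A).
Hypotheses (Fco : left_coideal F) (Vco : left_coideal V).

Lemma coefficientsZD s t a c d : coefficients F V s c -> coefficients F V t d ->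
  coefficients F V (s ++ t) (a *: c + d).
Proof.
move=> sc td; elim: s c sc => [c -> | phi s IH c [phiF [v Vv sc]]] /=.
  by rewrite scaler0 add0r.
split=> //; exists (a *: v); first by apply: subspaceZ => //; case: Vco.
by rewrite sliceRZ addrAC -scalerBr; exact: IH.
Qed.

(** The set is empty when a functional in s fails to vanish on F; the element c excludes this. *)
Lemma coefficients_subspace s c :
  coefficients F V s c -> subspace (coefficients F V s).
Proof.
have [Vsub _] := Vco; elim: s c => [|phi s IH] c /=.
  by move=> _; exact: left_coideal0.1.
move=> [phiF [v Vv /IH ssub]]; apply/subspaceP; split.
  split=> //; exists 0; first exact: subspace0.
  by rewrite -[X in R phi X](scale0r 0) sliceRZ scale0r subr0; exact: subspace0.
move=> a {}c d [_ [u Vu sc]] [_ [w Vw sd]]; split=> //.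
exists (a *: u + w); first exact: subspaceZD.
have -> : a *: c + d - R phi (a *: u + w) = a *: (c - R phi u) + (d - R phi w).
  by rewrite sliceRD sliceRZ opprD addrACA scalerBr.
exact: subspaceZD.
Qed.

Lemma coefficientsL s f c : coefficients F V s c -> coefficients F V s (L f c).
Proof.
elim: s c => [c -> | phi s IH c [phiF [v Vv sc]]] /=; first exact: sliceL0.
split=> //; exists (L f v); first exact: Vco.2.
by rewrite -(sliceLR slices) -sliceLB; exact: IH.
Qed.

(** A right slice of [R phi v] is again of this form, with phi replaced by phi after [L f], which
    still vanishes on the left coideal F. *)
Lemma coefficientsR s f c : coefficients F V s c ->
  exists t, coefficients F V t (R f c).
Proof.
move=> sc; exists [seq mk_scalar (sliceL_functional_is_scalar phi f) | phi <- s].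
elim: s c sc => [c -> | phi s IH c [phiF [v Vv sc]]] /=.
  by rewrite -[X in R f X](scale0r 0) sliceRZ scale0r.
split=> [u Fu | ]; first by apply: phiF; exact: Fco.2.
by exists v => //; rewrite -sliceRR -sliceRB; exact: IH.
Qed.

End Coefficients.

(** * Semi-invariants and group-likes *)

Hypothesis bialg : pointed_slices.

(* V over F is simple, so it embeds into the comodule spanned by a group-like
   occurring among its coefficients. *)
Lemma semi_invariant F N : left_coideal F -> left_coideal N -> F `<=` N ->
    (exists2 z, N z & ~ F z) ->
  exists y g, [/\ N y, ~ F y, glike g & forall f, F (L f y - f g *: y)].
Proof.
move=> Fco Nco FN Nz.
have [V [Vco FV VN [v0 Vv0 nFv0] Vmin]] := minimal_left_coideal Fco Nco FN Nz.
have [Fsub FL] := Fco; have [Vsub VL] := Vco.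
(* So [R phi v] depends only on v modulo F. *)
have RF phi u : (forall x, F x -> phi x = 0) -> F u -> R phi u = 0.
  move=> phiF Fu; apply: functional_eq => h.
  by rewrite -(slice_dual slices) linear0 phiF //; exact: FL.
have [phi0 [phi0F phi0v0]] := functional_separation Fsub nFv0.
(* All coefficients together form a subcoalgebra; it is nonzero because eps of [R phi0 v0] is
   phi0(v0) = 1. *)
have [||g glg [s sg]] :=
    subcoalgebra_glike bialg (C := [set c | exists s, coefficients F V s c]).
- split=> [|f c [s sc]|f c [s /(coefficientsR Fco f) [t tc]]].
  + apply/subspaceP; split; first by exists [::].
    by move=> a c d [s sc] [t td]; exists (s ++ t); exact: coefficientsZD.
  + by exists s; exact: coefficientsL.
  + by exists t.
- exists (R phi0 v0).
    by exists [:: phi0]; split=> //; exists v0; rewrite ?subrr.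
  move=> R0; have := slice_dual slices eps phi0 v0.
  rewrite R0 linear0 (sliceL_counit slices) phi0v0 => /eqP.
  by rewrite oner_eq0.
have [gL eg] := glg.
(* Drop functionals from s as long as g remains a coefficient: g then needs a term [R phi v] beyond
   those over t. *)
have [phi [t [phiF tsub ng [v Vv tg]]]] : exists phi t,
    [/\ forall u, F u -> phi u = 0, subspace (coefficients F V t),
     ~ coefficients F V t g & exists2 v, V v & coefficients F V t (g - R phi v)].
  elim: s sg => [/= g0 | phi s IH [phiF [v Vv sg]]].
    by move: eg; rewrite g0 linear0 => /eqP; rewrite eq_sym oner_eq0.
  have [/IH // | nsg] := pselect (coefficients F V s g).
  by exists phi, s; split=> //; [exact: coefficients_subspace sg | exists v].
(* W is the kernel of R phi on V modulo the coefficients over t. It does not contain v, so by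
   minimality it lies in F, while each [L f v - f g *: v] belongs to it. *)
pose W := V `&` [set w | coefficients F V t (R phi w)].
have Wco : left_coideal W.
  split; last first.
    move=> f w [Vw tw]; split; first exact: VL.
    by rewrite /= -(sliceLR slices); exact: coefficientsL.
  apply/subspaceP; split.
    split; first exact: subspace0.
    by rewrite /= RF //; exact: subspace0.
  move=> a x y [Vx tx] [Vy ty]; split; first exact: subspaceZD.
  by rewrite /= sliceRD sliceRZ; exact: subspaceZD.
have tv : ~ coefficients F V t (R phi v).
  by move=> tv; apply: ng; exact: subspaceBr tg.
have [||WF|VW] := Vmin W Wco.
- by move=> u Fu; split; [exact: FV | rewrite /= RF //; exact: subspace0].
- by move=> u [].
- exists v, g; split=> //; first exact: VN.
    by move=> Fv; apply: tv; rewrite RF //; exact: subspace0.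
  move=> f; apply: WF; split.
    by apply: subspaceB => //; [exact: VL | exact: subspaceZ].
  rewrite /= sliceRB sliceRZ -(sliceLR slices).
  have -> : L f (R phi v) - f g *: R phi v = f g *: (g - R phi v) - L f (g - R phi v).
    by rewrite sliceLB gL scalerBr [in RHS]addrC opprB [in RHS]addrA subrK.
  by apply: subspaceB => //; [exact: subspaceZ | exact: coefficientsL].
- by case: tv; exact: (VW _ Vv).2.
Qed.

Lemma sliceL_ext f phi x : f =1 phi -> L f x = L phi x.
Proof.
by move=> eq_f; apply: functional_eq => h; rewrite !(slice_dual slices).
Qed.

Lemma eps_sliceL f x : eps (L f x) = f x.
Proof. by rewrite (slice_dual slices) (sliceR_counit slices). Qed.

Lemma glike_represents g : glike g -> represents g [:: (g, g)].
Proof. by move=> [gL _] f; rewrite big_seq1. Qed.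

Lemma glike1 : glike 1.
Proof. by split; [move=> f; rewrite (sliceL1 bialg) | exact: eps1 bialg]. Qed.

Lemma glikeM g h : glike g -> glike h -> glike (g * h).
Proof.
move=> gg [hL eh]; split=> [f|]; last by rewrite (epsM bialg) eh gg.2 mulr1.
rewrite (sliceLM bialg _ _ (glike_represents gg)) big_seq1 hL /=.
by rewrite -scalerAr.
Qed.

Lemma glike_inv g : glike g -> glike (inv g).
Proof.
move=> gg; have [Vg gV] := glikeV bialg gg; split=> [f|].
  (* Slicing g * inv g = 1 with x -> f (inv g * x), then multiplying by [inv g] on the left,
     isolates [L f (inv g)]. *)
  have := sliceLM bialg (mull_functional f (inv g)) (inv g) (glike_represents gg).
  rewrite gV (sliceL1 bialg) big_seq1 /= mulr1 => /(congr1 ( *%R (inv g))).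
  rewrite -scalerAr mulr1 mulrA Vg mul1r => ->.
  by apply: sliceL_ext => x /=; rewrite !mulrA Vg mul1r.
have := epsM bialg (inv g) g; rewrite Vg (eps1 bialg) gg.2 mulr1; exact: esym.
Qed.

Fact mulr_functional_is_scalar f a : scalar (fun x => f (x * a)).
Proof. by move=> c x y; rewrite mulrDl -scalerAl linearP. Qed.

Definition mulr_functional f a := mk_scalar (mulr_functional_is_scalar f a).

Lemma represents_in K x : subspace K -> (forall f, K (L f x)) ->
  exists2 s, represents x s & {in s, forall p, K p.2}.
Proof.
move=> Ksub KL; have [s0 xs0] := sliceL_finite slices x.
have [|s [eq_s sK _]] := @tensor_support k A A K s0 Ksub.
  by move=> f; rewrite lslice_class -xs0.
by exists s => // f; rewrite xs0 -!lslice_class eq_s.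
Qed.

(** Since D is multiplicative, the elements whose slices stay in the algebra form a subalgebra, so
    generators suffice. *)
Lemma alg_left_coideal S : (forall f x, S x -> alg S (L f x)) -> left_coideal (alg S).
Proof.
move=> SL; have Asub := @alg_subspace k A S; split=> // f x Sx.
pose B := alg S `&` [set x | forall f, alg S (L f x)].
suff [_] : B x by apply.
apply: alg_sub Sx; last by move=> y Sy; split; [exact: sub_alg | move=> h; exact: SL].
apply/subalgebraP; split.
- split; first exact: alg1.
  by move=> h; rewrite (sliceL1 bialg); exact: algC.
- apply/subspaceP; split.
    split; first exact: (subspace0 Asub).
    exact: (subspace0 (sliceL_preim_subspace Asub)).
  move=> a u v [Su Lu] [Sv Lv]; split; first exact: (subspaceZD Asub).
  by move=> h; rewrite (sliceL_linear slices); exact: (subspaceZD Asub).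
move=> u v [Su Lu] [Sv Lv]; split; first exact: algM.
have [s us sS] := represents_in Asub Lu.
move=> h; rewrite (sliceLM bialg _ _ us).
by apply: (subspace_sum Asub) => p sp; apply: algM; [exact: sS | exact: Lv].
Qed.

(** * Adjoining a semi-invariant to a K-module *)

Definition lmodule K F : Prop := forall a x, K a -> F x -> F (a * x).

(* y is semi-invariant of weight g modulo F: D(y) lies in g (x) y + A (x) F. *)
Definition weight F g y : Prop := forall f, F (L f y - f g *: y).

(** D(ay) is a_1 g (x) a_2 y modulo A (x) F: the legs a_2 can be chosen in K, and K F lies in F. *)
Lemma sliceLM_weight K F f a g y : left_coideal K -> K a ->
    subspace F -> lmodule K F -> weight F g y ->
  F (L f (a * y) - L (mulr_functional f g) a * y).
Proof.
move=> [Ksub KL] Ka Fsub KF yg.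
have [s as_ sK] := represents_in Ksub (fun f => KL f a Ka).
rewrite (sliceLM bialg _ _ as_) as_ mulr_suml -sumrB.
apply: subspace_sum => // p sp.
have := KF _ _ (sK _ sp) (yg (mull_functional f p.1)).
by rewrite mulrBr -scalerAr -scalerAl.
Qed.

Definition extend K F y : set A := [set x | exists2 a, K a & F (x - a * y)].

Section GoodSubalgebra.
Variables (K : set A) (Kalg : subalgebra K) (Kco : left_coideal K).
Hypothesis KV : forall g, glike g -> K g -> K (inv g).

Let Ksub : subspace K. Proof. by case: Kco. Qed.

Let KM a b : K a -> K b -> K (a * b).
Proof. by have /subalgebraP[_ _] := Kalg; apply. Qed.

Section Extend.
Variables (F : set A) (g y : A).
Hypotheses (Fco : left_coideal F) (KF : lmodule K F).
Hypotheses (gg : glike g) (yg : weight F g y).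

Let Fsub : subspace F. Proof. by case: Fco. Qed.

Lemma sub_extend : F `<=` extend K F y.
Proof. by move=> x Fx; exists 0; rewrite ?mul0r ?subr0 //; exact: subspace0. Qed.

Lemma mem_extend : extend K F y y.
Proof.
have /subalgebraP[K1 _ _] := Kalg.
by exists 1; rewrite // mul1r subrr; exact: subspace0.
Qed.

Lemma extend_subspace : subspace (extend K F y).
Proof.
apply/subspaceP; split; first by apply: sub_extend; exact: subspace0.
move=> c x z [a Ka Fx] [b Kb Fz]; exists (c *: a + b); first exact: subspaceZD.
have -> : c *: x + z - (c *: a + b) * y = c *: (x - a * y) + (z - b * y).
  by rewrite mulrDl -scalerAl opprD addrACA scalerBr.
exact: subspaceZD.
Qed.

Lemma extend_left_coideal : left_coideal (extend K F y).
Proof.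
split=> [|f x [a Ka Fx]]; first exact: extend_subspace.
exists (L (mulr_functional f g) a); first exact: Kco.2.
have := subspaceD Fsub (sliceLM_weight f Kco Ka Fsub KF yg) (Fco.2 f _ Fx).
by rewrite sliceLB addrC subrKA.
Qed.

Lemma extend_lmodule : lmodule K (extend K F y).
Proof.
move=> a x Ka [b Kb Fx]; exists (a * b); first exact: KM.
by rewrite -mulrA -mulrBr; exact: KF.
Qed.

(* The annihilator of y modulo F is a left coideal and a left ideal of K; if
   it is nonzero, it contains a group-like, which is a unit of K. *)
Lemma extend_free a : ~ F y -> K a -> F (a * y) -> a = 0.
Proof.
move=> nFy Ka Fay; apply: contrapT => a0.
pose N := K `&` [set b | F (b * y)].
have [gV Vg] := glikeV bialg gg.
have Nco : left_coideal N.
  split=> [|f b [Kb Fb]].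
    apply/subspaceP; split=> [|c b d [Kb Fb] [Kd Fd]].
      by split; [exact: subspace0 | rewrite /= mul0r; exact: subspace0].
    by split; [exact: subspaceZD | rewrite /= mulrDl -scalerAl; exact: subspaceZD].
  split=> /=; first exact: Kco.2.
  (* As g is invertible, every f has the form x -> h (x * g), the form required by
     [sliceLM_weight]. *)
  pose h := mulr_functional f (inv g).
  have -> : L f b = L (mulr_functional h g) b.
    by apply: sliceL_ext => x /=; rewrite -mulrA Vg mulr1.
  have := subspaceB Fsub (Fco.2 h _ Fb) (sliceLM_weight h Kco Kb Fsub KF yg).
  by rewrite opprB addrC subrK.
have [_ ->||z [h [[Kz Fz] z0 hh zh]]] := semi_invariant left_coideal0 Nco.
- by split; [exact: subspace0 | rewrite /= mul0r; exact: subspace0].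
- by exists a.
have zE : z = eps z *: h.
  apply: functional_eq => f; have /eqP := zh f; rewrite subr_eq0 => /eqP Lz.
  by rewrite -(eps_sliceL f z) Lz !linearZ /= mulrC.
have ez : eps z != 0 by apply/eqP => ez; apply: z0; rewrite zE ez scale0r.
have hE : h = (eps z)^-1 *: z by rewrite {2}zE scalerA mulVf // scale1r.
have Kh : K h by rewrite hE; exact: subspaceZ.
apply: nFy; rewrite -[y]mul1r -(glikeV bialg hh).1 -mulrA.
apply: KF; first exact: KV.
by rewrite hE -scalerAl; exact: subspaceZ.
Qed.

End Extend.

(* The product K^+ F. *)
Definition augmentation F : set A :=
  lspan [set a * x | a in [set b | K b /\ eps b = 0] & x in F].

Lemma mem_augmentation F a x : K a -> eps a = 0 -> F x -> augmentation F (a * x).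
Proof. by move=> Ka ea Fx; apply: sub_lspan; exists a => //; exists x. Qed.

Lemma augmentation_lmodule F : subspace F -> lmodule K F -> augmentation F `<=` F.
Proof.
by move=> Fsub KF; apply: lspan_sub => // _ [a [Ka _] [x Fx <-]]; exact: KF.
Qed.

Lemma augmentation_extend F y t : subspace F -> lmodule K F ->
    augmentation (extend K F y) t ->
  exists a, [/\ K a, eps a = 0 & augmentation F (t - a * y)].
Proof.
move=> Fsub KF Et.
have Asub : subspace (augmentation F) by exact: lspan_subspace.
pose E := [set t | exists a, [/\ K a, eps a = 0 & augmentation F (t - a * y)]].
suff : E t by [].
apply: (lspan_sub _ _ Et) => [|_ [a [Ka ea] [x [b Kb Fx] <-]]].
  apply/subspaceP; split.
    exists 0; split; [exact: subspace0 | exact: linear0 |].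
    by rewrite mul0r subrr; exact: subspace0.
  move=> c u v [a [Ka ea Fu]] [b [Kb eb Fv]]; exists (c *: a + b); split.
  - exact: subspaceZD.
  - by rewrite linearP ea eb mulr0 addr0.
  have -> : c *: u + v - (c *: a + b) * y = c *: (u - a * y) + (v - b * y).
    by rewrite mulrDl -scalerAl opprD addrACA scalerBr.
  exact: (subspaceZD Asub).
exists (a * b); split; [exact: KM | by rewrite (epsM bialg) ea mul0r |].
by rewrite -mulrA -mulrBr; exact: mem_augmentation.
Qed.

(* Starting from F + K x, extend by free rank one K-modules until A is reached:
   freeness keeps x outside of F + K^+ E throughout. *)
Lemma weight_augmentation F g x t : left_coideal F -> lmodule K F ->
  glike g -> weight F g x -> augmentation setT t -> F (x - t) -> F x.
Proof.
move=> Fco KF gg xg Tt Ft; apply: contrapT => nFx; have [Fsub _] := Fco.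
pose P E := [/\ left_coideal E, lmodule K E, F `<=` E, E x &
  forall u, augmentation E u -> ~ F (x - u)].
have PF : P (extend K F x).
  split; [exact: extend_left_coideal Fco KF xg | exact: extend_lmodule |
    exact: sub_extend | exact: mem_extend |].
  move=> u /augmentation_extend[//|//|a [Ka ea Fu]] Fxu.
  (* Freeness would force a = 1, against eps a = 0. *)
  have : F ((1 - a) * x).
    have -> : (1 - a) * x = (x - u) + (u - a * x) by rewrite mulrBl mul1r subrKA.
    by apply: subspaceD => //; exact: (augmentation_lmodule Fsub KF Fu).
  have /subalgebraP[K1 _ _] := Kalg.
  move=> /(extend_free Fco KF gg xg nFx (subspaceB Ksub K1 Ka)) /eqP.
  rewrite subr_eq0 => /eqP a1; move: ea.
  by rewrite -a1 (eps1 bialg) => /eqP; rewrite oner_eq0.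
have [|E [[Eco KE FE Ex nE] _ Emax]] := Zorn_above PF.
  move=> C Cchain CF CP; split.
  - have Csub X : C X -> subspace X by move=> /CP[[]].
    split; last first.
      move=> f u [X CX Xu]; exists X => //.
      by have [[_ XL] _ _ _ _] := CP X CX; exact: XL.
    apply/subspaceP; split.
      by exists (extend K F x) => //; apply: subspace0; exact: extend_subspace.
    move=> c u v [X CX Xu] [Y CY Yv]; have [XY | YX] := Cchain _ _ CX CY.
      by exists Y => //; apply: subspaceZD (Csub Y CY) _ _ _ _ Yv; exact: XY.
    by exists X => //; apply: subspaceZD (Csub X CX) _ _ _ Xu _; exact: YX.
  - by move=> a u Ka [X CX Xu]; exists X => //; have [_ KX _ _ _] := CP X CX; exact: KX.
  - by move=> u Fu; exists (extend K F x) => //; exact: sub_extend.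
  - by exists (extend K F x) => //; exact: mem_extend.
  move=> u Cu; suff [X CX Xu] : exists2 X, C X & augmentation X u.
    by have [_ _ _ _] := CP X CX; apply.
  (* An element of K^+ times the union of the chain already comes from a single member. *)
  pose D := [set v | exists2 X, C X & augmentation X v].
  suff : D u by [].
  apply: (lspan_sub _ _ Cu) => [|_ [a [Ka ea] [v [X CX Xv] <-]]]; last first.
    by exists X => //; exact: mem_augmentation.
  have mono X Y : X `<=` Y -> augmentation X `<=` augmentation Y.
    move=> XY; apply: lspan_sub; first exact: lspan_subspace.
    by move=> _ [a [Ka ea] [v Xv <-]]; apply: mem_augmentation => //; exact: XY.
  have augsub X : subspace (augmentation X) by exact: lspan_subspace.
  apply/subspaceP; split.
    by exists (extend K F x) => //; exact: (subspace0 (augsub _)).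
  move=> c v w [X CX Xv] [Y CY Yw]; have [XY | YX] := Cchain _ _ CX CY.
    by exists Y => //; apply: (subspaceZD (augsub Y)) => //; exact: mono Xv.
  by exists X => //; apply: (subspaceZD (augsub X)) => //; exact: mono Yw.
have [ET | /existsNP[z nEz]] := pselect (forall z, E z).
  have {ET} ET : E = setT by apply/seteqP; split=> // z _; exact: ET.
  by apply: nE Ft; rewrite ET.
have [||y [h [_ nEy hh yh]]] := semi_invariant Eco left_coidealT; first by [].
  by exists z.
have [Esub _] := Eco.
have /Emax sub : P (extend K E y).
  split; [exact: extend_left_coideal Eco KE yh | exact: extend_lmodule | | |].
  - by move=> u /FE; exact: sub_extend.
  - exact: sub_extend.
  move=> u /augmentation_extend[//|//|a [Ka ea Eu]] Fxu.
  (* x, F and K^+ E all lie in E, hence so does a * y; freeness then gives a = 0, and u was already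
     in K^+ E. *)
  have Eay : E (a * y).
    have Euay := augmentation_lmodule Esub KE Eu.
    have := subspaceB Esub Ex (subspaceD Esub (FE _ Fxu) Euay).
    by rewrite subrKA opprB addrC subrK.
  have a0 := extend_free Eco KE hh yh nEy Ka Eay.
  by apply: nE Fxu; move: Eu; rewrite a0 mul0r subr0.
by apply: nEy; apply: sub; [exact: sub_extend | exact: mem_extend].
Qed.

End GoodSubalgebra.

(** * Subalgebras K to which the freeness argument applies *)

Definition good K : Prop :=
  [/\ subalgebra K, left_coideal K & forall g, glike g -> K g -> K (inv g)].

Lemma weight_glike K g : subspace K -> glike g -> weight K g g.
Proof. by move=> Ksub [gL _] f; rewrite gL subrr; exact: subspace0. Qed.

(** The case F = K of [weight_augmentation]. *)
Lemma good_weight_augmentation K g x t : good K -> glike g -> weight K g x ->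
  augmentation K setT t -> K (x - t) -> K x.
Proof.
move=> [Kalg Kco KV] gg xg Tt; apply: (weight_augmentation Kalg Kco KV Kco) gg xg Tt.
by have /subalgebraP[_ _] := Kalg.
Qed.

Lemma inv_uniq g h : glike g -> h * g = 1 -> h = inv g.
Proof.
by move=> gg hg; rewrite -[h]mulr1 -(glikeV bialg gg).2 mulrA hg mul1r.
Qed.

Lemma inv_inv g : glike g -> inv (inv g) = g.
Proof.
move=> gg; apply/esym/inv_uniq; [exact: glike_inv | exact: (glikeV bialg gg).2].
Qed.

(** The algebra is spanned by the group N of those group-likes lying in it with their inverses.
    Linear independence of group-likes, in the form of [glike_in_span], leaves room for no
    others. *)
Lemma good_group S : S `<=` glike -> (forall g, S g -> alg S (inv g)) -> good (alg S).
Proof.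
move=> Sg SV; split; first exact: alg_subalgebra.
  apply: alg_left_coideal => f x Sx; rewrite (Sg _ Sx).1.
  by apply: (subspaceZ (@alg_subspace k A S)); exact: sub_alg.
pose N := [set h | [/\ glike h, alg S h & alg S (inv h)]].
have NM g h : N g -> N h -> N (g * h).
  move=> [gg Kg Kg'] [hh Kh Kh']; split; [exact: glikeM | exact: algM |].
  rewrite -(inv_uniq (h := inv h * inv g)); [exact: algM | exact: glikeM |].
  rewrite mulrA -[_ * g]mulrA (glikeV bialg gg).1 mulr1.
  exact: (glikeV bialg hh).1.
have Nsub := @lspan_subspace k A N.
have SN : alg S `<=` lspan N.
  apply: alg_sub => [|g Sg']; last first.
    by apply: sub_lspan; split; [exact: Sg | exact: sub_alg | exact: SV].
  apply/subalgebraP; split=> //.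
    apply: sub_lspan; split; [exact: glike1 | exact: alg1 |].
    by rewrite -(inv_uniq glike1 (mulr1 1)); exact: alg1.
  move=> x y Nx Ny.
  suff Nxy : lspan N `<=` [set u | lspan N (u * y)] by exact: Nxy.
  apply: lspan_sub => [|g Ng].
    apply/subspaceP; split=> [|a u v Nu Nv] /=.
      by rewrite mul0r; exact: (subspace0 Nsub).
    by rewrite mulrDl -scalerAl; exact: (subspaceZD Nsub).
  suff gN : lspan N `<=` [set v | lspan N (g * v)] by exact: gN.
  apply: lspan_sub => [|h Nh]; last by apply: sub_lspan; exact: NM.
  apply/subspaceP; split=> [|a u v Nu Nv] /=.
    by rewrite mulr0; exact: (subspace0 Nsub).
  by rewrite mulrDr -scalerAr; exact: (subspaceZD Nsub).
move=> h hh /SN Nh; have [hL eh] := hh.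
(* The line through h is a left coideal inside the span of N, so it contains some g in N; eps then
   shows g = h. *)
have [|||||g Ng [c gh]] := glike_in_span (sliceL_linear slices) eps_sliceL
    (N := N) (E := [set x | exists c, x = c *: h]).
- by move=> g [[]].
- apply/subspaceP; split; first by exists 0; rewrite scale0r.
  by move=> a _ _ [b ->] [c ->]; exists (a * b + c); rewrite scalerDl scalerA.
- by move=> f _ [c ->]; exists (c * f h); rewrite sliceLZ hL scalerA.
- by move=> _ [c ->]; exact: (subspaceZ Nsub).
- exists h; first by exists 1; rewrite scale1r.
  by move=> h0; move: eh; rewrite h0 linear0 => /eqP; rewrite eq_sym oner_eq0.
have c1 : c = 1.
  by have [[_ eg] _ _] := Ng; move: eg; rewrite gh linearZ /= eh mulr1.
by move: Ng; rewrite gh c1 scale1r => -[].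
Qed.

Lemma good_extension S : glike `<=` alg S -> (forall f x, S x -> alg S (L f x)) ->
  good (alg S).
Proof.
move=> Sg SL; split; [exact: alg_subalgebra | exact: alg_left_coideal |].
by move=> g gg _; apply: Sg; exact: glike_inv.
Qed.

(** * The right ideals K^+ A and right Noetherian A *)

Lemma augmentation_right_ideal K : right_ideal (augmentation K setT).
Proof.
have Asub : subspace (augmentation K setT) by exact: lspan_subspace.
split; [exact: (subspace0 Asub) | by move=> x y; exact: (subspaceD Asub) |].
move=> a x Kx.
suff Ka : augmentation K setT `<=` [set u | augmentation K setT (u * a)] by exact: Ka.
apply: lspan_sub => [|_ [b [Kb eb] [y _ <-]]]; last first.
  by rewrite /= -mulrA; exact: mem_augmentation.
apply/subspaceP; split=> [|c u v Ku Kv] /=.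
  by rewrite mul0r; exact: (subspace0 Asub).
by rewrite mulrDl -scalerAl; exact: (subspaceZD Asub).
Qed.

(** The witness for strictness is y - eps(y): it lies in K'^+, and were it in K^+ A, then y would be
    in K. *)
Lemma augmentation_grow K K' g y : good K -> subalgebra K' -> K `<=` K' ->
    glike g -> weight K g y -> ~ K y -> K' y ->
  augmentation K setT `<=` augmentation K' setT /\
  ~ augmentation K' setT `<=` augmentation K setT.
Proof.
move=> Kgood /subalgebraP[K'1 K'sub _] KK' gg yg nKy K'y; split.
  apply: lspan_sub; first exact: lspan_subspace.
  by move=> _ [a [Ka ea] [x _ <-]]; apply: mem_augmentation => //; exact: KK'.
move=> sub; have [/subalgebraP[K1 Ksub _] _ _] := Kgood.
apply: nKy; apply: (good_weight_augmentation Kgood gg yg (t := y - (eps y)%:A)).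
  apply: sub; rewrite -[_ - _]mulr1; apply: mem_augmentation => //.
    by apply: subspaceB => //; exact: subspaceZ.
  by rewrite linearB linearZ /= (eps1 bialg) mulr1 subrr.
by rewrite opprB addrC subrK; exact: subspaceZ.
Qed.

(* Group-likes are adjoined before any other generator. *)
Definition fg_good K : Prop := good K /\ exists2 s : seq A, K = alg [set` s] &
  glike `<=` K \/ {in s, forall g, glike g /\ inv g \in s}.

(** A group-like missing from K is adjoined together with its inverse; once K contains all
    group-likes, a semi-invariant modulo K is adjoined instead. *)
Lemma fg_good_grow K : fg_good K -> K <> setT ->
  exists K', [/\ fg_good K', augmentation K setT `<=` augmentation K' setT &
    ~ augmentation K' setT `<=` augmentation K setT].
Proof.
move=> [Kgood [s Ks Kglike]] KT; have [Kalg Kco KV] := Kgood; have [Ksub KL] := Kco.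
have sub_cons t : {subset s <= t} -> K `<=` alg [set` t].
  move=> st; rewrite Ks; apply: alg_sub; first exact: alg_subalgebra.
  by move=> x sx; apply: sub_alg; exact: st.
have [Kg | nKg] := pselect (glike `<=` K).
  have [||y [g [_ nKy gg yg]]] := semi_invariant Kco left_coidealT.
- by [].
- apply: contrapT => nK; apply: KT; apply/seteqP; split=> // x _.
    by apply: contrapT => nKx; apply: nK; exists x.
  have KK' : K `<=` alg [set` y :: s].
    by apply: sub_cons => x sx; rewrite inE sx orbT.
  have K'y : alg [set` y :: s] y by apply: sub_alg; exact: mem_head.
  have K'good : good (alg [set` y :: s]).
    apply: good_extension => [|f x]; first exact: subset_trans Kg KK'.
    rewrite /= inE => /predU1P[-> | sx].
      apply: (subspaceBr (@alg_subspace _ _ _) _ (KK' _ (yg f))).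
      by apply: (subspaceZ (@alg_subspace _ _ _)).
    have Kx : K x by rewrite Ks; exact: sub_alg.
    exact: (KK' _ (KL f x Kx)).
  exists (alg [set` y :: s]).
  have [|le nle] := augmentation_grow Kgood _ KK' gg yg nKy K'y; first by case: K'good.
  split=> //; split=> //.
  by exists (y :: s) => //; left; exact: subset_trans Kg KK'.
have {Kglike} sg : {in s, forall g, glike g /\ inv g \in s} by case: Kglike.
have /existsNP[g /not_implyP[gg nKgg]] := nKg.
pose t := [:: g, inv g & s].
have tg : {in t, forall h, glike h /\ inv h \in t}.
  move=> h; rewrite !inE => /or3P[/eqP-> | /eqP-> | /sg[hh sh]].
  - by split=> //; rewrite eqxx orbT.
  - by split; [exact: glike_inv | rewrite inv_inv // eqxx].
  by split; rewrite // sh !orbT.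
have K'good : good (alg [set` t]).
  by apply: good_group => h /tg[] // _ ht; exact: sub_alg.
exists (alg [set` t]).
have [|||||||le nle] := @augmentation_grow K (alg [set` t]) g g.
- by [].
- by case: K'good.
- by apply: sub_cons => x sx; rewrite !inE sx !orbT.
- by [].
- exact: weight_glike.
- by [].
- by apply: sub_alg; rewrite /= mem_head.
by split=> //; split=> //; exists t => //; right.
Qed.

Lemma right_noetherian_affine : right_noetherian A -> affine A.
Proof.
move=> noeth; apply: contrapT => naff.
have grow (K : {K | fg_good K}) : {K' : {K | fg_good K} |
    augmentation (sval K) setT `<=` augmentation (sval K') setT /\
    ~ augmentation (sval K') setT `<=` augmentation (sval K) setT}.
  apply: cid; case: K => K fgK /=; have [|K' [fgK' le nle]] := fg_good_grow fgK.
    move=> KT; have [_ [s Ks _]] := fgK; apply: naff; exists s.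
    by rewrite /generates_algebra -Ks.
  by exists (exist _ K' fgK').
(* The chain starts from the scalars, the algebra generated by no element. *)
have fg0 : fg_good (alg [set` [::]]).
  by split; [exact: good_group | exists [::] => //; right].
pose K n := iter n (fun M : {K | fg_good K} => sval (grow M)) (exist _ _ fg0).
have [||n nmax] := noeth (fun n => augmentation (sval (K n)) setT).
- by move=> n; exact: augmentation_right_ideal.
- by move=> n; exact: (svalP (grow (K n))).1.
have nle : ~ augmentation (sval (K n.+1)) setT `<=` augmentation (sval (K n)) setT.
  exact: (svalP (grow (K n))).2.
by apply: nle; rewrite (nmax n.+1 (leqnSn n)).
Qed.

(** * Exhausting A by iterated semi-invariants *)

Fixpoint stage n : set A :=
  if n is m.+1 then [set x | exists2 g, glike g & weight (alg (stage m)) g x]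
  else glike.

Lemma alg_mono S T : S `<=` T -> alg S `<=` alg T.
Proof.
move=> ST; apply: alg_sub; first exact: alg_subalgebra.
by move=> x /ST; exact: sub_alg.
Qed.

Lemma stageS n : stage n `<=` stage n.+1.
Proof.
elim: n => [|n IH] x /=.
  by move=> gx; exists x => //; apply: weight_glike => //; exact: alg_subspace.
by move=> [g gg xg]; exists g => // f; exact: alg_mono (xg f).
Qed.

Lemma stage_mono m n : (m <= n)%N -> stage m `<=` stage n.
Proof.
move=> /subnK <-; elim: (n - m)%N => // d IH x mx; rewrite addSn.
by apply: stageS; exact: IH.
Qed.

Lemma glike_stage n : glike `<=` stage n.
Proof. exact: (@stage_mono 0). Qed.

(** For n = 0 the predecessor is again 0; a group-like is semi-invariant modulo any subspace. *)
Lemma stage_weight n x : stage n x ->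
  exists2 g, glike g & weight (alg (stage n.-1)) g x.
Proof.
case: n => [gx | n] //=; exists x => //; apply: weight_glike => //.
exact: alg_subspace.
Qed.

Lemma weightL K F g x f : subspace F -> K `<=` F -> weight K g x -> F x -> F (L f x).
Proof.
move=> Fsub KF xg Fx; apply: (subspaceBr Fsub _ (KF _ (xg f))).
exact: subspaceZ.
Qed.

Lemma alg_stage_left_coideal n : left_coideal (alg (stage n)).
Proof.
apply: alg_left_coideal => f x nx; have [g _ xg] := stage_weight nx.
apply: weightL xg _; [exact: alg_subspace | | exact: sub_alg].
by apply: alg_mono; apply: stage_mono; exact: leq_pred.
Qed.

(** The union U of the stage algebras is a left coideal. A semi-invariant y modulo U outside U would
    involve finitely many legs in U, all at one level n, so y would belong to stage n.+1. *)
Lemma stage_exhaust x : exists n, alg (stage n) x.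
Proof.
pose U := [set x | exists n, alg (stage n) x].
have mono m n z : (m <= n)%N -> alg (stage m) z -> alg (stage n) z.
  by move=> /stage_mono /alg_mono; apply.
have Uco : left_coideal U.
  split; last by move=> f z [n nz]; exists n; exact: (alg_stage_left_coideal n).2.
  apply/subspaceP; split; first by exists 0%N; exact: (subspace0 (@alg_subspace _ _ _)).
  move=> a u v [m mu] [n nv]; exists (maxn m n).
  apply: (subspaceZD (@alg_subspace _ _ _)).
    by apply: mono mu; exact: leq_maxl.
  by apply: mono nv; exact: leq_maxr.
have [Usub _] := Uco.
apply: contrapT => nUx.
have [||y [g [_ nUy gg yg]]] := semi_invariant Uco left_coidealT.
- by [].
- by exists x.
have [s ys] := sliceL_finite slices y.
(* The sequence presents D(y) - g (x) y. *)
have [|t [st tU _]] := @tensor_support k A A U ((g, - y) :: s) Usub.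
  move=> f; rewrite lslice_class big_cons -ys /= scalerN addrC.
  exact: yg.
have [n tn] : exists n, {in t, forall p, alg (stage n) p.2}.
  elim: t tU {st} => [|p t IH] tU; first by exists 0%N.
  have [|n tn] := IH; first by move=> q tq; apply: tU; rewrite inE tq orbT.
  have [m pm] := tU p (mem_head _ _).
  exists (maxn m n) => q; rewrite inE => /predU1P[-> | /tn nq].
    by apply: mono pm; exact: leq_maxl.
  by apply: mono nq; exact: leq_maxr.
apply: nUy; exists n.+1; apply: sub_alg; exists g => // f.
have -> : L f y - f g *: y = \sum_(p <- t) f p.1 *: p.2.
  by rewrite -lslice_class -st lslice_class big_cons -ys /= scalerN addrC.
apply: subspace_sum => [|p tp]; first exact: alg_subspace.
by apply: (subspaceZ (@alg_subspace _ _ _)); exact: tn.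
Qed.

(** * The letters, and why the irreducible ones suffice *)

Section Letters.
Variables (W : rel A) (wo_W : well_order W).

Local Notation le := (nat_lexi W).

(* The images x - eps(x) lie in the augmentation ideal, which makes right
   multiples of smaller letters lie in K^+ A; letters (n, x) with x outside of
   stage n are junk. *)
Definition mirrored : {pred nat * A} := [pred p | (p.1 == 0%N) && `[< glike p.2 >]].

Definition image (l : letter mirrored) : A :=
  match l with
  | inl p => if `[< stage p.1 p.2 >] then p.2 - (eps p.2)%:A else 0
  | inr p => inv (val p).2 - 1
  end.

Arguments image : simpl never.

Definition below x : set A := [set image l | l in [set l | ltO le (orig l) x]].

Lemma mirroredP (p : {p | p \in mirrored}) : (val p).1 = 0%N /\ glike (val p).2.
Proof. by have /andP[/eqP-> /asboolP] := valP p. Qed.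

Lemma image_stage n x (nx : stage n x) : image (inl (n, x)) = x - (eps x)%:A.
Proof. by rewrite /image /= asboolT. Qed.

Lemma eps_image l : eps (image l) = 0.
Proof.
case: l => [[n x] | p] /=; rewrite /image /=.
  case: ifP => _; last exact: linear0.
  by rewrite linearB linearZ /= (eps1 bialg) mulr1 subrr.
have [_ gp] := mirroredP p.
by rewrite linearB /= (eps1 bialg) (glike_inv gp).2 subrr.
Qed.

Lemma ltO_lexi m n x y : (m < n)%N -> ltO le (m, x) (n, y).
Proof.
move=> mn; rewrite /ltO /nat_lexi /= mn andbT.
by apply: contraL mn => /eqP[-> _]; rewrite ltnn.
Qed.

Lemma ltO_stage x y : ltO le x y -> (x.1 <= y.1)%N.
Proof. by move=> /andP[_ /orP[/ltnW // | /andP[/eqP-> _]]]. Qed.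

Lemma stage_below m n x : (m < n)%N -> stage m `<=` alg (below (n, x)).
Proof.
move=> mn y my; apply: (alg_shift (a := eps y)); rewrite -(image_stage my).
by apply: sub_alg; exists (inl (m, y)) => //; exact: ltO_lexi.
Qed.

Lemma alg_stage_below m n x : (m < n)%N -> alg (stage m) `<=` alg (below (n, x)).
Proof.
by move=> mn; apply: alg_sub; [exact: alg_subalgebra | exact: stage_below].
Qed.

(** On level 0 the smaller letters generate the same algebra as a set of group-likes closed under
    inverses. On higher levels all group-likes are already below, and only the left coideal
    condition remains. *)
Lemma alg_below_good x : good (alg (below x)).
Proof.
case: x => -[|n] x.
  (* The second alternative accounts for mirrors: g - 1 is the image of the mirror of [inv g]. *)
  pose S := [set g | glike g /\
    (ltO le (0%N, g) (0%N, x) \/ ltO le (0%N, inv g) (0%N, x))].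
  suff -> : alg (below (0%N, x)) = alg S.
    apply: good_group => [g [] // | g [gg Sg]]; apply: sub_alg.
    by split; [exact: glike_inv | rewrite inv_inv //; case: Sg; [right | left]].
  apply/seteqP; split; apply: alg_sub (alg_subalgebra _) _.
    move=> _ [[[m y] | p] lex <-].
      have := ltO_stage lex; rewrite leqn0 => /eqP /= m0.
      rewrite m0 in lex *; rewrite /image /=; case: ifP => [/asboolP gy | _]; last first.
        exact: (subspace0 (@alg_subspace _ _ _)).
      apply: (subspaceB (@alg_subspace _ _ _)); last exact: algC.
      by apply: sub_alg; split=> //; left.
    have [p0 gp] := mirroredP p.
    apply: (subspaceB (@alg_subspace _ _ _)); last exact: alg1.
    apply: sub_alg; split; first exact: glike_inv.
    by right; rewrite inv_inv //; move: lex; rewrite /= [val p]surjective_pairing p0.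
  move=> g [gg [lt_g | lt_g]].
    apply: (alg_shift (a := eps g)); rewrite -(@image_stage 0 g gg).
    by apply: sub_alg; exists (inl (0%N, g)).
  have Vg : (0%N, inv g) \in mirrored.
    by apply/andP; split=> //; apply/asboolP; exact: glike_inv.
  apply: (alg_shift (a := 1)); rewrite scale1r -{1}(inv_inv gg).
  by apply: sub_alg; exists (inr (exist _ (0%N, inv g) Vg)).
have nsub := @stage_below n n.+1 x (ltnSn n).
have Asub := @alg_subspace _ _ (below (n.+1, x)).
apply: good_extension; first exact: subset_trans (@glike_stage n) nsub.
move=> f _ [l lx <-]; case: l lx => [[m y] | p] /= lx; rewrite /image /=.
  case: ifP => [/asboolP my | _]; last by rewrite sliceL0; exact: (subspace0 Asub).
  rewrite sliceLB sliceLZ (sliceL1 bialg) scalerA.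
  apply: (subspaceB Asub); last exact: algC.
  have [g _ yg] := stage_weight my; apply: weightL yg _ => //.
    apply: alg_stage_below; have := ltO_stage lx; rewrite /= => mn.
    by case: (m) mn.
  apply: (alg_shift (a := eps y)); rewrite -(image_stage my).
  by apply: sub_alg; exists (inl (m, y)).
have [_ gp] := mirroredP p.
rewrite sliceLB (sliceL1 bialg) (glike_inv gp).1.
apply: (subspaceB Asub); last exact: algC.
by apply: (subspaceZ Asub); apply: nsub; apply: glike_stage; exact: glike_inv.
Qed.

Lemma weight_below n x : stage n x ->
  exists2 g, glike g & weight (alg (below (n, x))) g x.
Proof.
case: n => [gx | n] /=.
  by exists x => //; apply: weight_glike => //; exact: alg_subspace.
by move=> [g gg xg]; exists g => // f; exact: alg_stage_below (xg f).
Qed.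

(** A word below the letter l is empty, or begins with a letter of smaller origin, or, for a mirror
    only, is the unmirrored letter. These give the scalar, the element of K^+ A and the multiple
    d. *)
Lemma reducible_image l : reducible le (ker_proj (k := k) image) (fmu l) ->
  exists c d t, augmentation (alg (below (orig l))) setT t /\
    image l = c%:A + d *: (if is_mirror l then image (inl (orig l)) else 0) + t.
Proof.
move=> [p [_ p0 [lp lmax]]].
set v := (if _ then _ else _).
pose E := [set z | exists c d t, augmentation (alg (below (orig l))) setT t /\
   z = c%:A + d *: v + t].
have Asub : subspace (augmentation (alg (below (orig l))) setT).
  exact: lspan_subspace.
have Esub : subspace E.
  apply/subspaceP; split.
    by exists 0, 0, 0; split; [exact: (subspace0 Asub) | rewrite !scale0r !addr0].
  move=> a _ _ [c [d [t [At ->]]]] [c' [d' [t' [At' ->]]]].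
  exists (a * c + c'), (a * d + d'), (a *: t + t'); split; first exact: (subspaceZD Asub).
  by rewrite !scalerDr !scalerDl !scalerA addrACA; congr (_ + _); exact: addrACA.
have Eone : E 1.
  exists 1, 0, 0; split; first exact: (subspace0 Asub).
  by rewrite scale1r scale0r !addr0.
have small b : b != fmu l -> lt_red le b (fmu l) -> E (word_eval image b).
  move=> bl; rewrite /lt_red; case bE: (b : seq _) => [|z b'].
    by move=> _; rewrite /word_eval bE big_nil; exact: Eone.
  rewrite fmU /= /word_eval bE big_cons => -[zl | [zl [// | [b0 lex]]]].
    (* The first letter maps into K^+ and the rest of the word anywhere in A. *)
    exists 0, 0, (image z * \prod_(x <- b') image x).
    split; last by rewrite !scale0r !add0r.
    apply: mem_augmentation => //; last exact: eps_image.
    by apply: sub_alg; exists z.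
  (* With equal origins the word has length one, and its letter can only be the unmirrored copy of
     l. *)
  case: b' {bE} b0 lex => // _ [[y [c //]] | [[|a c] [x [d [y [e [xE yE lt_zl]]]]]]].
    move: lt_zl; case: xE yE => <- _ [<- _] [|[_ nz ml]].
      by rewrite zl /ltO eqxx.
    exists 0, 1, 0; split; first exact: (subspace0 Asub).
    rewrite big_nil mulr1 scale0r scale1r add0r addr0 /v ml -zl.
    by case: z nz {zl}.
  by case: xE => _; case: (c).
(* The relation given by p is solved for its leading letter. *)
have lE : p@_(fmu l) *: image l =
    - \sum_(b <- msupp p | b != fmu l) p@_b *: word_eval image b.
  have := p0; rewrite /ker_proj /= /proj mmapE.
  rewrite (bigD1_seq (fmu l) lp (fset_uniq _)) /= => /eqP; rewrite addr_eq0 => /eqP.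
  rewrite mulr_algl /word_eval fmU big_seq1 => ->; congr (- _).
  by apply: eq_bigr => b _; rewrite mulr_algl.
have pl : p@_(fmu l) != 0 by rewrite mcoeff_neq0.
suff : E (image l) by [].
rewrite -[image l]scale1r -(mulVf pl) -scalerA lE.
apply: subspaceZ => //; rewrite -[- _]add0r.
apply: subspaceB; [exact: Esub | exact: subspace0 |].
rewrite big_seq_cond; apply: big_ind => [|x y|b /andP[pb bl]].
- exact: subspace0.
- exact: subspaceD.
by apply: subspaceZ => //; apply: small => //; exact: lmax.
Qed.

Lemma image_in_alg_irreducible (B : set A) : subalgebra B ->
    (forall l, irreducible_letters le (ker_proj (k := k) image) l -> B (image l)) ->
  forall l, B (image l).
Proof.
move=> Balg Birr l; have [x xl] : {x | orig l = x} by exists (orig l).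
have /subalgebraP[B1 Bsub BM] := Balg.
move: x l xl; apply: (wo_induction (nat_lexi_wo wo_W)) => x IH.
have KB : alg (below x) `<=` B.
  by apply: alg_sub => // _ [l lx <-]; exact: IH lx _ erefl.
have [Kalg Kco KV] := alg_below_good x; have [Ksub KL] := Kco.
have /subalgebraP[K1 _ KM] := Kalg.
(* The unmirrored letter is settled first, because the mirror case needs g in B. *)
have Binl : B (image (inl x)).
  have [/reducible_image | irr] :=
    pselect (reducible le (ker_proj (k := k) image) (fmu (inl x))); last exact: Birr.
  move=> [c [d [t [Kt]]]] /=; rewrite scaler0 addr0.
  case: x Kt {IH} KB Kalg Kco KV Ksub KL K1 KM => n x Kt KB Kalg Kco KV Ksub KL K1 KM.
  have [nx | nnx] := pselect (stage n x); last first.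
    by rewrite /image /= asboolF // => _; exact: subspace0.
  rewrite image_stage // => xE.
  have [g gg xg] := weight_below nx.
  apply: subspaceB => //; last exact: subspaceZ.
  apply: KB; apply: (good_weight_augmentation (alg_below_good _) gg xg Kt).
  have -> : x - t = (c + eps x)%:A.
    by rewrite scalerDl -[x in LHS](subrK (eps x)%:A) xE addrAC addrK.
  exact: algC.
case=> [y /= yx | p /= px]; first by rewrite yx.
have [p0 gp] := mirroredP p; set g := (val p).2 in gp.
have xE : x = (0%N, g) by rewrite -px [val p]surjective_pairing p0.
rewrite xE in KB Kalg Kco KV Ksub KL K1 KM Binl => {IH px}.
have Bg : B g.
  apply: (subspaceBr Bsub (subspaceZ Bsub (eps g) B1)).
  by rewrite -(@image_stage 0).
have [/reducible_image | irr] :=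
  pselect (reducible le (ker_proj (k := k) image) (fmu (inr p))); last exact: Birr.
rewrite [orig _]surjective_pairing p0 -/g /= (@image_stage 0 g gp).
move=> [c [d [t [Kt ]]]].
set K := alg (below (0%N, g)) in Kt KB Kalg Kco KV Ksub KL K1 KM *.
rewrite /image -/g => VgE.
have gK : weight K g g by exact: weight_glike.
have Vgg := glike_inv gp.
have Fsub : subspace (extend K K g) by exact: extend_subspace.
(* Taking F = K + K g absorbs the multiple of g - 1 in the relation for the mirror; then [inv g] is
   semi-invariant modulo F and lies in F + K^+ A, hence in F. *)
have [b Kb Kgb] : extend K K g (inv g).
  apply: (weight_augmentation Kalg Kco KV (g := inv g) _ _ Vgg _ Kt).
  - exact: (extend_left_coideal Kco Kco KM gK).
  - exact: (extend_lmodule Kalg KM).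
  - exact: weight_glike.
  exists d%:A; first exact: algC.
  have -> : inv g - t - d%:A * g = (1 + c - d * eps g)%:A.
    rewrite -[inv g](subrK 1) VgE scalerBr mulr_algl scalerBl scalerDl scale1r scalerA.
    rewrite [_ + t + 1]addrAC addrK [1 + _]addrC.
    by rewrite addrAC addrCA [d *: g + _]addrC addrK addrAC.
  exact: algC.
apply: subspaceB => //; apply: (subspaceBr Bsub _ (KB _ Kgb)).
by apply: BM => //; exact: KB.
Qed.

Lemma image_generates (B : set A) : subalgebra B -> (forall l, B (image l)) ->
  forall x, B x.
Proof.
move=> Balg BI x; have [n] := stage_exhaust x.
apply: alg_sub => // y ny; have /subalgebraP[B1 Bsub _] := Balg.
apply: (subspaceBr Bsub (subspaceZ Bsub (eps y) B1)).
by rewrite -(image_stage ny).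
Qed.

End Letters.

Lemma irreducible_letters_generate :
  exists (O : choiceType) (leO : rel O) (D : {pred O}) (fX : letter D -> A),
    [/\ well_order leO,
        generates_algebra (range fX) &
        generates_algebra
          (proj fX @` (gen k @` irreducible_letters leO (ker_proj fX)))].
Proof.
have [W wo_W] := well_ordering_principle A.
(* Letters are pairs of a level and an element; any well order of A serves within a level. *)
exists _, (nat_lexi W), mirrored, image; split; first exact: nat_lexi_wo.
  apply/seteqP; split=> // x _; apply: image_generates; first exact: alg_subalgebra.
  by move=> l; apply: sub_alg; exists l.
apply/seteqP; split=> // x _; apply: image_generates; first exact: alg_subalgebra.
apply: (image_in_alg_irreducible wo_W); first exact: alg_subalgebra.
move=> l irr; apply: sub_alg; exists (gen k l); last exact: proj_gen.
by exists l.
Qed.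

End Slices.

(** * The slices of a pointed Hopf algebra *)

Section HopfSlices.
Context (k : fieldType) (H : hopfAlgType k).
Implicit Types (f g : {scalar H}) (x y : H).

Definition sliceL f x : H := lslice f (comul x).
Definition sliceR f x : H := rslice f (comul x).

Lemma preim_subspace (V U : lmodType k) (F : {linear V -> U}) (B : set U) :
  subspace B -> subspace [set v | B (F v)].
Proof.
move=> Bsub; apply/subspaceP; split=> [|a u v Bu Bv] /=.
  by rewrite linear0; exact: subspace0.
by rewrite linearP; exact: subspaceZD.
Qed.

Lemma big_linear (V U : lmodType k) (F : V -> U) (I : Type) (r : seq I) (h : I -> V) :
  linear F -> F (\sum_(i <- r) h i) = \sum_(i <- r) F (h i).
Proof.
move=> Flin; apply: (big_morph F) => [u v|].
  by have := Flin 1 u v; rewrite !scale1r.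
by have := Flin (-1) 0 0; rewrite scaler0 addr0 scaleN1r addNr.
Qed.

Lemma comul_sum x : comul x = \sum_(p <- repr (comul x)) tens p.1 p.2.
Proof. exact: tensorE. Qed.

Lemma sliceL_repr f x : sliceL f x = \sum_(p <- repr (comul x)) f p.1 *: p.2.
Proof. by rewrite -lslice_class tens_repr. Qed.

Lemma sliceR_repr f x : sliceR f x = \sum_(p <- repr (comul x)) f p.2 *: p.1.
Proof. by rewrite -rslice_class tens_repr. Qed.

Fact sliceL_is_linear f : linear (sliceL f).
Proof. by move=> a x y; rewrite /sliceL !linearP. Qed.

Fact sliceR_is_linear f : linear (sliceR f).
Proof. by move=> a x y; rewrite /sliceR !linearP. Qed.

Fact sliceL_sliceR f g x : sliceL f (sliceR g x) = sliceR g (sliceL f x).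
Proof.
(* This is f (x) id (x) g; applied to both sides of coassociativity it yields the claim. *)
pose mid := tlift (fun u t => f u *: rslice g t) : tensor H (tensor H H) -> H.
have midl (t : tensor H H) : linear (fun u : H => f u *: rslice g t).
  by move=> a u v; rewrite linearP scalerDl scalerA.
have midr (u : H) : linear (fun t : tensor H H => f u *: rslice g t).
  by move=> a s t; rewrite rslice_is_linear scalerDr !scalerA mulrC.
have mid_tens (u : H) (t : tensor H H) : mid (tens u t) = f u *: rslice g t.
  exact: tlift_tens.
have mid_lin : linear mid by exact: tlift_is_linear.
have assl (w : H) : linear (fun t : tensor H H => tlift (fun u v => tens u (tens v w)) t).
  apply: tlift_is_linear => z a u v; first exact: tens_is_linear_l.
  by rewrite tens_is_linear_l tens_is_linear_r.
have assr (t : tensor H H) :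
    linear (fun w : H => tlift (fun u v : H => tens u (tens v w)) t).
  move=> a u v; rewrite /tlift scaler_sumr -big_split /=.
  by apply: eq_bigr => p _; rewrite !tens_is_linear_r.
have ass_lin : linear (@tassoc k H H H) by exact: tlift_is_linear.
have tmap_lin (V W : lmodType k) (h : {linear H -> V}) (h' : {linear H -> W}) :
    linear (tmap h h').
  apply: tlift_is_linear => [w | v] a u u'; rewrite linearP.
    exact: tens_is_linear_l.
  exact: tens_is_linear_r.
have := congr1 mid (comulA x).
rewrite {1 2}comul_sum !(big_linear _ _ (tmap_lin _ _ _ _)) (big_linear _ _ ass_lin).
rewrite !(big_linear _ _ mid_lin).
have mid_assoc t (b : H) : mid (tassoc (tens t b)) = g b *: lslice f t.
  rewrite -(tens_repr t) {1}tens_classE (big_linear _ _ (tens_is_linear_l b)).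
  rewrite (big_linear _ _ ass_lin) (big_linear _ _ mid_lin) lslice_class scaler_sumr.
  apply: eq_bigr => p _; rewrite tassoc_tens mid_tens.
  by rewrite -[tens p.2 b]/(tens_class [:: (_, _)]) rslice_class big_seq1 !scalerA mulrC.
under eq_bigr do rewrite tmap_tens mid_assoc.
under [in RHS]eq_bigr do rewrite tmap_tens mid_tens.
rewrite (sliceR_repr g x) (sliceL_repr f x) /sliceL /sliceR !linear_sum => mid_eq.
under eq_bigr do rewrite !linearZ.
under [in RHS]eq_bigr do rewrite !linearZ.
exact: mid_eq.
Qed.

Lemma H_coalgebra_slices : coalgebra_slices sliceL sliceR counit.
Proof.
split.
- exact: sliceL_is_linear.
- exact: sliceR_is_linear.
- by move=> f g x; exact: lslice_rslice.
- exact: sliceL_sliceR.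
- exact: counitl.
- exact: counitr.
by move=> x; exists (repr (comul x)) => f; exact: sliceL_repr.
Qed.

Lemma represents_comul x s : represents sliceL x s -> comul x = tens_class s.
Proof. by move=> xs; apply: lslice_inj => f; rewrite lslice_class -xs. Qed.

Lemma tmul_class (s t : seq (H * H)) : tmul (tens_class s) (tens_class t) =
  \sum_(p <- s) \sum_(q <- t) tens (p.1 * q.1) (p.2 * q.2).
Proof.
have linl (x y z : H) : linear (fun c : H => tens (x * c) (y * z)).
  by move=> r u v; rewrite mulrDr -scalerAr tens_is_linear_l.
have linr (x y z : H) : linear (fun d : H => tens (x * z) (y * d)).
  by move=> r u v; rewrite mulrDr -scalerAr tens_is_linear_r.
rewrite /tmul tlift_class.
- by apply: eq_bigr => p _; rewrite tlift_class.
- move=> w r x y; rewrite /tlift scaler_sumr -big_split /=.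
  by apply: eq_bigr => p _; rewrite mulrDl -scalerAl tens_is_linear_l.
- move=> w r x y; rewrite /tlift scaler_sumr -big_split /=.
  by apply: eq_bigr => p _; rewrite mulrDl -scalerAl tens_is_linear_r.
Qed.

Lemma lslice_tens f x y : lslice f (tens x y) = f x *: y.
Proof. by rewrite /tens lslice_class big_seq1. Qed.

Lemma rslice_tens f x y : rslice f (tens x y) = f y *: x.
Proof. by rewrite /tens rslice_class big_seq1. Qed.

Lemma sliceL_mul f x s y : represents sliceL x s ->
  sliceL f (x * y) = \sum_(p <- s) p.2 * sliceL (mull_functional f p.1) y.
Proof.
move=> /represents_comul xs; rewrite /sliceL comulM xs -{1}(tens_repr (comul y)).
rewrite tmul_class (big_linear _ _ (lslice_is_linear f)); apply: eq_bigr => p _.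
rewrite (big_linear _ _ (lslice_is_linear f)) -/(sliceL _ _) sliceL_repr mulr_sumr.
by apply: eq_bigr => q _; rewrite lslice_tens -scalerAr.
Qed.

(** Here s lists the legs of D(x) in swapped order and the product is y * x, as this serves as the
    product rule in the opposite algebra. *)
Lemma sliceR_mul f x s y :
  (forall h : {scalar H}, sliceR h x = \sum_(p <- s) h p.1 *: p.2) ->
  sliceR f (y * x) = \sum_(p <- s) sliceR (mulr_functional f p.1) y * p.2.
Proof.
move=> xs; have {}xs : comul x = tens_class [seq (p.2, p.1) | p <- s].
  by apply: rslice_inj => h; rewrite rslice_class big_map -xs.
rewrite /sliceR comulM xs -{1}(tens_repr (comul y)).
rewrite tmul_class linear_sum; under eq_bigr do rewrite linear_sum big_map /=.
rewrite exchange_big; apply: eq_bigr => p _; rewrite -/(sliceR _ _) sliceR_repr mulr_suml.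
by apply: eq_bigr => q _; rewrite rslice_tens -scalerAl.
Qed.

Lemma glike_grouplike x : glike sliceL counit x -> grouplike x.
Proof.
move=> [xL ex]; split=> //; apply: lslice_inj => f.
by rewrite lslice_tens -xL.
Qed.

Lemma grouplike_glike x : grouplike x -> glike sliceL counit x.
Proof. by move=> [xx ex]; split=> // f; rewrite /sliceL xx lslice_tens. Qed.

Lemma grouplikeV x : grouplike x -> antipode x * x = 1 /\ x * antipode x = 1.
Proof.
move=> [xx ex]; have := antipodel x; have := antipoder x.
rewrite xx ex scale1r tlift_tens => [xS||]; last 2 first.
- by move=> w a u v; rewrite mulrDl -scalerAl.
- by move=> w a u v; rewrite linearP mulrDr -scalerAr.
rewrite tlift_tens // => w a u v; last by rewrite mulrDr -scalerAr.
by rewrite linearP mulrDl -scalerAl.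
Qed.

(** A minimal nonzero subcoalgebra inside C is simple, hence lies in the coradical, which is the
    span of the group-likes; [glike_in_span] then finds one in it. *)
Lemma pointed_subcoalgebra (C : set H) : pointed H -> subcoalg sliceL sliceR C ->
  (exists2 x, C x & x <> 0) -> exists2 g, grouplike g & C g.
Proof.
move=> Hpt Cco Cx.
have [E [[Esub EL ER] EC Ez Emin]] := minimal_subcoalgebra H_coalgebra_slices Cco Cx.
have Esimple : simple_subcoalgebra E.
  split.
  - split=> // x Ex.
    pose swap (s : seq (H * H)) := [seq (p.2, p.1) | p <- s].
    have swapK (s : seq (H * H)) f :
        rslice f (tens_class s) = lslice f (tens_class (swap s)).
      by rewrite rslice_class lslice_class big_map.
    (* [tensor_support] is used once on the swapped presentation and once on the result, so that
       both legs end up in E. *)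
    have [|s [ss sE _]] := @tensor_support k H H E (swap (repr (comul x))) Esub.
      by move=> f; rewrite -swapK tens_repr; exact: ER.
    have xs : comul x = tens_class (swap s).
      apply: rslice_inj => f; rewrite swapK /swap -map_comp map_id_in; last by case.
      by rewrite -ss -swapK tens_repr.
    have [|t [st tE sub]] := @tensor_support k H H E (swap s) Esub.
      by move=> f; rewrite -xs; exact: EL.
    rewrite xs st tens_classE /tensor_subspace.
    apply: (subspace_sum (@lspan_subspace _ _ _)) => p tp; apply: sub_lspan.
    exists p.1; last by exists p.2 => //; exact: tE.
    have /sub/mapP[_ /mapP[q sq ->] ->] : p.1 \in unzip1 t by exact: map_f.
    exact: sE.
  - by move=> E0; have [z + ] := Ez; rewrite E0.
  move=> B [Bsub BB] BE.
  have [||B0|EB] := Emin B.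
  - split=> // f x /BB.
      apply: (lspan_sub (E := [set t | B (lslice f t)])).
        exact: (preim_subspace (lslice f)).
      move=> _ [a Ba [b Bb <-]]; rewrite /= lslice_tens; exact: subspaceZ.
    apply: (lspan_sub (E := [set t | B (rslice f t)])).
      exact: (preim_subspace (rslice f)).
    move=> _ [a Ba [b Bb <-]]; rewrite /= rslice_tens; exact: subspaceZ.
  - by [].
  - by left; apply/seteqP; split=> // _ ->; exact: subspace0.
  - by right; apply/seteqP.
have [||||||//|g gg Eg] := @glike_in_span k H sliceL counit (@grouplike k H) E.
- exact: sliceL_is_linear.
- exact: (eps_sliceL (H_coalgebra_slices)).
- by move=> g /grouplike_glike[].
- exact: Esub.
- exact: EL.
- by rewrite -Hpt => x Ex; apply: sub_lspan; exists E.
by exists g => //; exact: EC.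
Qed.

Hypothesis Hpt : pointed H.

Lemma sliceL_pointed : pointed_slices sliceL sliceR counit antipode.
Proof.
split.
- by move=> f; rewrite /sliceL comul1 lslice_tens.
- exact: sliceL_mul.
- exact: counit1.
- exact: counitM.
- by move=> g /glike_grouplike; exact: grouplikeV.
move=> C Cco Cx; have [g gg Cg] := pointed_subcoalgebra Hpt Cco Cx.
by exists g => //; exact: grouplike_glike.
Qed.

End HopfSlices.

(** * The opposite algebra with the co-opposite comultiplication *)

Section Opposite.
Context (k : fieldType) (A : algType k).

HB.instance Definition _ := GRing.Lmodule.copy A^c A.

Fact converse_scalerAl (a : k) (x y : A^c) : a *: (x * y) = (a *: x : A^c) * y.
Proof. exact: (@scalerAr k A a y x). Qed.

HB.instance Definition _ :=
  GRing.Lmodule_isLalgebra.Build k A^c converse_scalerAl.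

Fact converse_scalerAr (a : k) (x y : A^c) : a *: (x * y) = x * (a *: y : A^c).
Proof. exact: (@scalerAl k A a y x). Qed.

HB.instance Definition _ :=
  GRing.Lalgebra_isAlgebra.Build k A^c converse_scalerAr.

Lemma affine_converse : affine A^c -> affine A.
Proof.
move=> [s gen_s]; exists s; apply/seteqP; split=> // x _.
have : (alg [set` s] : set A^c) x by rewrite gen_s.
apply: alg_sub => [|y sy]; last exact: sub_alg.
apply/subalgebraP; split; [exact: alg1 | exact: alg_subspace |].
by move=> y z sy sz; exact: (algM (A := A) sz sy).
Qed.

End Opposite.

Section OppositeHopf.
Context (k : fieldType) (H : hopfAlgType k).

Lemma converse_coalgebra_slices :
  @coalgebra_slices k H^c (@sliceR k H) (@sliceL k H) counit.
Proof.
split.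
- exact: (@sliceR_is_linear k H).
- exact: (@sliceL_is_linear k H).
- by move=> f g x; rewrite /sliceR /sliceL; exact: esym (@lslice_rslice k H H g f _).
- by move=> f g x; exact: esym (@sliceL_sliceR k H g f x).
- exact: (@counitr k H).
- exact: (@counitl k H).
move=> x; exists [seq (p.2, p.1) | p <- repr (comul (x : H))] => f.
by rewrite big_map; exact: sliceR_repr.
Qed.

(** Reversing both product and coproduct keeps the group-likes and their inverses, so the same
    antipode serves as [inv]. *)
Lemma converse_pointed_slices : pointed H ->
  @pointed_slices k H^c (@sliceR k H) (@sliceL k H) counit (@antipode k H).
Proof.
have grouplike_converse g :
    @glike k H^c (@sliceR k H) counit g <-> grouplike (g : H).
  split=> [[gR eg] | [gg eg]]; split=> //.
    by apply: rslice_inj => f; rewrite rslice_tens -gR.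
  by move=> f; rewrite /sliceR gg rslice_tens.
move=> Hpt; split.
- by move=> f; rewrite /sliceR comul1 rslice_tens.
- move=> f x s y /(@sliceR_mul k H f x s y) yx; apply: (etrans yx).
  by apply: eq_bigr => p _; congr (_ * _); rewrite !sliceR_repr.
- exact: (@counit1 k H).
- by move=> x y; rewrite mulrC; exact: (@counitM k H y x).
- by move=> g /grouplike_converse/grouplikeV[gV Vg].
move=> C [Csub CR CL] Cx.
have [|g /grouplike_converse gg Cg] := @pointed_subcoalgebra k H C Hpt _ Cx.
  by split=> //; exact: Csub.
by exists g.
Qed.

End OppositeHopf.

Theorem theoremB (k : fieldType) (H : hopfAlgType k) (Hpt : pointed H) :
  (exists (O : choiceType) (leO : rel O) (D : {pred O}) (fX : letter D -> H),
     [/\ well_order leO,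
         generates_algebra (range fX) &
         generates_algebra
           (proj fX @` (gen k @` irreducible_letters leO (ker_proj fX)))])
  /\ (right_noetherian H \/ left_noetherian H -> affine H).
Proof.
split.
  exact: (irreducible_letters_generate (H_coalgebra_slices H) (sliceL_pointed Hpt)).
case=> [Hr | Hl].
  exact: (right_noetherian_affine (H_coalgebra_slices H) (sliceL_pointed Hpt)).
(* Left ideals of H are by conversion the right ideals of [H^c]. *)
apply: affine_converse.
exact: (right_noetherian_affine (converse_coalgebra_slices H)
          (converse_pointed_slices Hpt) Hl).
Qed.
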